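(* Let $\rho>0$. Then: (a) There exists a unique stationary $\mathcal H_K^{++}$-valued process $(\mathsf W_n)_{n\in\mathbb Z}$ satisfying \[ \mathsf W_n = \left( I + \rho \, \mathsf G_n^* \left( I + \rho \,\mathsf F_n \mathsf W_{n-1} \mathsf F_n^* \right)^{-1} \mathsf G_n \right)^{-1}. \] In particular, the process $(\mathsf W_n)$ is ergodic. (b) The mutual information per component admits the representation \[ \mathcal I_\rho = \frac1N\Big( \mathbb E\log\det\left( I + \rho \,\mathsf F_0 \mathsf W_{-1} \mathsf F_0^* \right)-\mathbb E \log\det \mathsf W_0 \Big). \] (c) Given any matrix $\mathsf X_{-1} \in \mathcal H_K^{+}$, if one defines a process $(\mathsf X_n)_{n\in\mathbb N}$ by \[ \mathsf X_n := \left( I + \rho \, \mathsf G_n^* \left( I + \rho \,\mathsf F_n \mathsf X_{n-1} \mathsf F_n^* \right)^{-1} \mathsf G_n \right)^{-1}, \qquad n\geq 0, \] then almost surely \[ \mathcal I_\rho = \lim_{n\to\infty} \frac{1}{nN} \sum_{\ell=0}^{n-1} \Big(\log\det \left( I + \rho \,\mathsf F_\ell \mathsf X_{\ell-1} \mathsf F_\ell^* \right) - \log\det \mathsf X_\ell\Big). \]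
   Context: Consider the transmission model $Y_n = \mathsf F_n S_{n-1} + \mathsf G_n S_n + V_n$, $n\in\mathbb Z$, with $\mathsf F_n,\mathsf G_n\in\mathbb C^{N\times K}$, where $(S_n)$ is i.i.d. $\mathcal{CN}(0,I_K)$, $(V_n)$ is i.i.d. $\mathcal{CN}(0,\rho^{-1}I_N)$, and $(S_n)$, $(\mathsf F_n,\mathsf G_n)$, $(V_n)$ are independent. Assume the channel process $(\mathsf F_n,\mathsf G_n)_{n\in\mathbb Z}$, with values in $E:=\mathbb C^{N\times K}\times\mathbb C^{N\times K}$, is stationary and ergodic with $\mathbb E\|\mathsf F_0\|^2<\infty$ and $\mathbb E\|\mathsf G_0\|^2<\infty$ (spectral norm). For $m\le n$ let $\mathsf H_{m,n}$ be the $(n-m+1)N\times(n-m+2)K$ block bidiagonal matrix whose $i$-th block row (for $i=m,\dots,n$) contains $\mathsf F_i$ and $\mathsf G_i$ in consecutive block columns $i-m+1$ and $i-m+2$ and zeros elsewhere. The mutual information per component is $\mathcal I_\rho := \lim_{n-m\to\infty}\frac{1}{(n-m+1)N}\log\det(I+\rho\,\mathsf H_{m,n}\mathsf H_{m,n}^* )$ a.s. (equal to the limit of the expectations). $\mathcal H_K^{++}$ (resp. $\mathcal H_K^{+}$) denotes the cone of $K\times K$ Hermitian positive definite (resp. semidefinite) matrices. *)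

(* Defs.v *)
From HB Require Import structures.
From mathcomp Require Import all_boot all_order all_algebra.
From mathcomp Require Import all_classical all_reals all_analysis.
From mathcomp Require Import complex.
Set Implicit Arguments. Unset Strict Implicit. Unset Printing Implicit Defensive.
Import Order.TTheory GRing.Theory Num.Theory.
Import numFieldTopology.Exports numFieldNormedType.Exports.
Local Open Scope classical_set_scope.
Local Open Scope ring_scope.

Section Defs.
Variable R : realType.
Local Notation C := R[i].

Definition ctr (p q : nat) (M : 'M[C]_(p, q)) : 'M[C]_(q, p) :=
  map_mx (@conjc R) M^T.

Definition hermitian (p : nat) (M : 'M[C]_p) : Prop := ctr M = M.
Definition hpd (p : nat) (M : 'M[C]_p) : Prop :=
  hermitian M /\ forall v : 'cV[C]_p, v != 0 -> 0 < (ctr v *m M *m v) 0 0.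
Definition hpsd (p : nat) (M : 'M[C]_p) : Prop :=
  hermitian M /\ forall v : 'cV[C]_p, 0 <= (ctr v *m M *m v) 0 0.

(** log det of a (Hermitian positive definite) matrix: the determinant is
    then a positive real number *)
Definition logdet (p : nat) (M : 'M[C]_p) : R := ln (complex.Re (\det M)).

Definition specnorm (p q : nat) (M : 'M[C]_(p, q)) : R :=
  sup [set Num.sqrt (complex.Re ((ctr v *m ctr M *m M *m v) 0 0)) |
        v in [set v : 'cV[C]_q | (ctr v *m v) 0 0 = 1]].

Definition Wstep (N K : nat) (rho : R) (F G : 'M[C]_(N, K)) (X : 'M[C]_K)
  : 'M[C]_K :=
  invmx (1%:M + (rho%:C)%C *: (ctr G *m invmx (1%:M + (rho%:C)%C *: (F *m X *m ctr F))
                              *m G)).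

Definition ldF (N K : nat) (rho : R) (F : 'M[C]_(N, K)) (X : 'M[C]_K) : R :=
  logdet (1%:M + (rho%:C)%C *: (F *m X *m ctr F)).

Lemma mod_lt_ord (L N : nat) (i : 'I_(L * N)) : (i %% N < N)%N.
Proof.
case: N i => [|N] i; last by rewrite ltn_mod.
by case: i => i; rewrite muln0.
Qed.

(** Block bidiagonal matrix H_{m,m+L-1}: L block rows, L+1 block columns;
    block row r (0 <= r < L) holds F_{m+r} in block column r and
    G_{m+r} in block column r+1. *)
Definition Hmat (N K : nat) (F G : int -> 'M[C]_(N, K)) (m : int) (L : nat)
  : 'M[C]_(L * N, L.+1 * K) :=
  \matrix_(i < L * N, j < L.+1 * K)
    let r := (i %/ N)%N in let a := Ordinal (mod_lt_ord i) in
    let c := (j %/ K)%N in let b := Ordinal (mod_lt_ord j) in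
    if c == r then (F (m + r%:Z)%R) a b
    else if c == r.+1 then (G (m + r%:Z)%R) a b
    else 0.

Definition cmx_coord (p q : nat) (M : 'M[C]_(p, q))
  (t : 'I_p * 'I_q * bool) : R :=
  if t.2 then complex.Re (M t.1.1 t.1.2) else complex.Im (M t.1.1 t.1.2).
Definition pair_coord (p q : nat) (FG : 'M[C]_(p, q) * 'M[C]_(p, q))
  (t : bool * ('I_p * 'I_q * bool)) : R :=
  cmx_coord (if t.1 then FG.1 else FG.2) t.2.

Definition cylinders (I : Type) : set (set (int -> I -> R)) :=
  [set A | exists (k : int) (i : I) (B : set R),
     measurable B /\ A = (fun x : int -> I -> R => x k i) @^-1` B].
Definition path_measurable (I : Type) (A : set (int -> I -> R)) : Prop :=
  smallest (sigma_algebra setT) (@cylinders I) A.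
Definition pshift (I : Type) (x : int -> I -> R) : int -> I -> R :=
  fun k => x (k + 1)%R.

Context (d : measure_display) (Omega : measurableType d)
        (P : probability Omega R).

Definition path (T I : Type) (c : T -> I -> R) (Z : int -> Omega -> T)
  (w : Omega) : int -> I -> R := fun k i => c (Z k w) i.

Definition rprocess (T I : Type) (c : T -> I -> R) (Z : int -> Omega -> T)
  : Prop := forall k i, measurable_fun setT (fun w => c (Z k w) i).

Definition stationary (T I : Type) (c : T -> I -> R) (Z : int -> Omega -> T)
  : Prop :=
  rprocess c Z /\
  forall A, path_measurable A ->
    P ((fun w => pshift (path c Z w)) @^-1` A) = P (path c Z @^-1` A).

Definition ergodic (T I : Type) (c : T -> I -> R) (Z : int -> Omega -> T)
  : Prop :=
  forall A, path_measurable A -> (@pshift I) @^-1` A = A ->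
    P (path c Z @^-1` A) = 0%E \/ P (path c Z @^-1` A) = 1%E.

Definition mutual_info (N K : nat) (F G : int -> Omega -> 'M[C]_(N, K))
  (rho : R) : R :=
  lim ((fun L : nat => ((L * N)%:R)^-1 *
     Rintegral P setT (fun w => logdet (1%:M + (rho%:C)%C *:
         (Hmat (F ^~ w) (G ^~ w) 0 L *m ctr (Hmat (F ^~ w) (G ^~ w) 0 L)))))
     @ \oo).

(** the process X_n of part (c): Xrec 0 = X_{-1}, Xrec (n+1) = X_n *)
Fixpoint Xrec (N K : nat) (rho : R) (F G : int -> 'M[C]_(N, K))
  (Xm1 : 'M[C]_K) (n : nat) : 'M[C]_K :=
  match n with
  | 0 => Xm1
  | n'.+1 => Wstep rho (F n'%:Z) (G n'%:Z) (Xrec rho F G Xm1 n')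
  end.

End Defs.

(* Main.v *)
(** Write f_n for the map X |-> Wstep rho (F n) (G n) X. It is monotone for the
    Loewner order, and with a = rho tr (G_n^* G_n) it satisfies
    f_n X <= 1 <= (1 + a) f_n X, and Y <= (1 + e) X implies
    f_n Y <= (1 + a / (1 + a) e) f_n X. Hence f_n ... f_(n-j) 1 decreases, for
    every channel path, to a solution W_n which is a measurable equivariant
    function of the path, so it inherits stationarity and ergodicity. By
    stationarity the gains a_n are almost surely bounded along a subsequence
    in both time directions, so the contraction factors multiply to 0; this
    gives uniqueness, and makes every forward trajectory approach W.

    Peeling off the first block row of H with a Schur complement (and the
    Woodbury identity) gives log det (1 + rho H H^* ) as the sum over the steps
    of ldF (F_l) X_(l-1) - log det X_l, with X_(-1) = 1. By stationarity the
    l-th expectation is that of the solution started l steps in the past, so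
    dominated convergence and Cesaro yield (b); Birkhoff's theorem applied to
    W and the comparison of trajectories yield (c). *)

From Pilot Require Import Defs.
From HB Require Import structures.
From mathcomp Require Import all_boot all_order all_algebra.
From mathcomp Require Import all_classical all_reals all_analysis.
From mathcomp Require Import measurable_realfun complex.
From mathcomp Require Import ring lra.
Import Order.TTheory GRing.Theory Num.Theory.
Import numFieldTopology.Exports numFieldNormedType.Exports.
Local Open Scope classical_set_scope.
Local Open Scope ring_scope.
Set Implicit Arguments. Unset Strict Implicit. Unset Printing Implicit Defensive.

(** * Hermitian matrices and the Loewner order *)

Section ConjTranspose.
Variable R : realType.
Local Notation C := R[i].
Local Notation "r %:C" := (real_complex R r).
Implicit Types (m n p : nat).

(** Two solutions are compared through factors [1 + e] with [Y <= (1 + e) X] rather than through a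
    norm, because such a relation passes through congruences, and through inversions with the two
    sides exchanged. The obstacle is that the rate [a / (1 + a)] depends on a gain that need not be
    bounded, so no fixed rate below 1 is available; integrability of the gain gives no pathwise
    bound either, and recurrence takes its place. The comparison has to start somewhere, and the
    bounds [f_n X <= 1 <= (1 + a) f_n X] start it with the gain of that single step; the starting
    time must therefore be one at which the gain is itself bounded. The identity is the natural
    starting point since it dominates every value of the step. Stationarity is a property of laws
    and [Omega] carries no shift, so the ergodic theorem is proved for a measure-preserving map,
    used on the space of paths under the law of the channel, and pulled back. *)

Lemma ctrK m n (A : 'M[C]_(m, n)) : ctr (ctr A) = A.
Proof. by apply/matrixP => i j; rewrite !mxE conjcK. Qed.

Lemma ctrM m n p (A : 'M[C]_(m, n)) (B : 'M[C]_(n, p)) :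
  ctr (A *m B) = ctr B *m ctr A.
Proof. by rewrite /ctr trmx_mul map_mxM. Qed.

Lemma ctrD m n (A B : 'M[C]_(m, n)) : ctr (A + B) = ctr A + ctr B.
Proof. by rewrite /ctr linearD /= map_mxD. Qed.

Lemma ctrN m n (A : 'M[C]_(m, n)) : ctr (- A) = - ctr A.
Proof. by rewrite /ctr linearN /= map_mxN. Qed.

Lemma ctrB m n (A B : 'M[C]_(m, n)) : ctr (A - B) = ctr A - ctr B.
Proof. by rewrite ctrD ctrN. Qed.

Lemma ctr1 n : ctr (1%:M : 'M[C]_n) = 1%:M.
Proof. by rewrite /ctr trmx1 map_mx1. Qed.

Lemma ctrZ m n (r : R) (A : 'M[C]_(m, n)) : ctr (r%:C *: A) = r%:C *: ctr A.
Proof. by rewrite /ctr linearZ /= map_mxZ -[in RHS](conjc_real r). Qed.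

Lemma ctr_inv n (A : 'M[C]_n) : ctr (invmx A) = invmx (ctr A).
Proof. by rewrite /ctr trmx_inv map_invmx. Qed.

Lemma hermD n (A B : 'M[C]_n) :
  Defs.hermitian A -> Defs.hermitian B -> Defs.hermitian (A + B).
Proof. by rewrite /Defs.hermitian ctrD => -> ->. Qed.

Lemma hermB n (A B : 'M[C]_n) :
  Defs.hermitian A -> Defs.hermitian B -> Defs.hermitian (A - B).
Proof. by rewrite /Defs.hermitian ctrB => -> ->. Qed.

Lemma herm1 n : Defs.hermitian (1%:M : 'M[C]_n).
Proof. exact: ctr1. Qed.

Lemma herm0 n : Defs.hermitian (0 : 'M[C]_n).
Proof. by rewrite /Defs.hermitian /ctr trmx0 map_mx0. Qed.

Lemma hermZ n (r : R) (A : 'M[C]_n) : Defs.hermitian A -> Defs.hermitian (r%:C *: A).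
Proof. by rewrite /Defs.hermitian ctrZ => ->. Qed.

Lemma herm_inv n (A : 'M[C]_n) : Defs.hermitian A -> Defs.hermitian (invmx A).
Proof. by rewrite /Defs.hermitian ctr_inv => ->. Qed.

Lemma herm_congr m n (B : 'M[C]_(m, n)) (A : 'M[C]_n) :
  Defs.hermitian A -> Defs.hermitian (B *m A *m ctr B).
Proof. by rewrite /Defs.hermitian !ctrM ctrK mulmxA => ->. Qed.

Definition qf n (A : 'M[C]_n) (v : 'cV[C]_n) : R :=
  complex.Re ((ctr v *m A *m v) 0 0).

Definition psd n (A : 'M[C]_n) : Prop := forall v, 0 <= qf A v.

(** The Loewner order, on real parts of the forms. Hermitian symmetry is carried separately, so
    comparisons stay in the ordered field [R]. *)
Definition lew n (A B : 'M[C]_n) : Prop := forall v, qf A v <= qf B v.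

Lemma cReD (x y : C) : complex.Re (x + y) = complex.Re x + complex.Re y.
Proof. by case: x y => [? ?] [? ?]. Qed.
Lemma cReN (x : C) : complex.Re (- x) = - complex.Re x.
Proof. by case: x. Qed.
Lemma cReZ (r : R) (x : C) : complex.Re (r%:C * x) = r * complex.Re x.
Proof. by case: x => [? ?] /=; rewrite mul0r subr0. Qed.
Lemma cImD (x y : C) : complex.Im (x + y) = complex.Im x + complex.Im y.
Proof. by case: x y => [? ?] [? ?]. Qed.
Lemma cReM (x y : C) :
  complex.Re (x * y) = complex.Re x * complex.Re y - complex.Im x * complex.Im y.
Proof. by case: x y => [? ?] [? ?]. Qed.
Lemma cImM (x y : C) :
  complex.Im (x * y) = complex.Re x * complex.Im y + complex.Im x * complex.Re y.
Proof. by case: x y => [? ?] [? ?]. Qed.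
Lemma cRe_sum (I : Type) (s : seq I) (f : I -> C) :
  complex.Re (\sum_(i <- s) f i) = \sum_(i <- s) complex.Re (f i).
Proof. by elim/big_rec2: _ => //= i y x _ <-; rewrite cReD. Qed.
Lemma cRe_conjM (x : C) :
  complex.Re (x^*%C * x) = complex.Re x ^+ 2 + complex.Im x ^+ 2.
Proof. by case: x => [a b] /=; rewrite !expr2; ring. Qed.
Lemma complex_eqP (x y : C) :
  complex.Re x = complex.Re y -> complex.Im x = complex.Im y -> x = y.
Proof. by case: x y => [a b] [c e] /= -> ->. Qed.

Lemma qfD n (A B : 'M[C]_n) v : qf (A + B) v = qf A v + qf B v.
Proof. by rewrite /qf mulmxDr mulmxDl mxE cReD. Qed.
Lemma qfN n (A : 'M[C]_n) v : qf (- A) v = - qf A v.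
Proof. by rewrite /qf mulmxN mulNmx mxE cReN. Qed.
Lemma qfB n (A B : 'M[C]_n) v : qf (A - B) v = qf A v - qf B v.
Proof. by rewrite qfD qfN. Qed.
Lemma qfZ n (r : R) (A : 'M[C]_n) v : qf (r%:C *: A) v = r * qf A v.
Proof. by rewrite /qf -scalemxAr -scalemxAl mxE cReZ. Qed.
Lemma qf_congr m n (B : 'M[C]_(m, n)) (A : 'M[C]_n) v :
  qf (B *m A *m ctr B) v = qf A (ctr B *m v).
Proof. by rewrite /qf ctrM ctrK !mulmxA. Qed.
Lemma qf_congr' m n (B : 'M[C]_(n, m)) (A : 'M[C]_n) v :
  qf (ctr B *m A *m B) v = qf A (B *m v).
Proof. by rewrite -{2}(ctrK B) qf_congr ctrK. Qed.
Lemma qf1E n (v : 'cV[C]_n) :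
  qf 1%:M v = \sum_i (complex.Re (v i 0) ^+ 2 + complex.Im (v i 0) ^+ 2).
Proof.
rewrite /qf mulmx1 mxE cRe_sum; apply: eq_bigr => i _.
by rewrite !mxE cRe_conjM.
Qed.

Lemma qf1_ge0 n (v : 'cV[C]_n) : 0 <= qf 1%:M v.
Proof. by rewrite qf1E sumr_ge0 // => i _; rewrite addr_ge0 // sqr_ge0. Qed.

Lemma qf1_gt0 n (v : 'cV[C]_n) : v != 0 -> 0 < qf 1%:M v.
Proof.
move=> v0; rewrite lt_def qf1_ge0 andbT; apply: contra v0 => /eqP.
rewrite qf1E => /psumr_eq0P H; apply/eqP/matrixP => i j; rewrite ord1 mxE.
have /eqP : complex.Re (v i 0) ^+ 2 + complex.Im (v i 0) ^+ 2 = 0.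
  by apply: H => // k _; rewrite addr_ge0 // sqr_ge0.
rewrite paddr_eq0 ?sqr_ge0 // !sqrf_eq0 => /andP[/eqP a /eqP b].
exact: complex_eqP.
Qed.

Lemma qf0 n v : qf (0 : 'M[C]_n) v = 0.
Proof. by rewrite /qf mulmx0 mul0mx mxE. Qed.

Lemma psd1 n : psd (1%:M : 'M[C]_n).
Proof. exact: qf1_ge0. Qed.
Lemma psd0 n : psd (0 : 'M[C]_n).
Proof. by move=> v; rewrite qf0. Qed.
Lemma psdZ n (r : R) (A : 'M[C]_n) : 0 <= r -> psd A -> psd (r%:C *: A).
Proof. by move=> r0 a v; rewrite qfZ mulr_ge0. Qed.
Lemma psd_congr m n (B : 'M[C]_(m, n)) (A : 'M[C]_n) :
  psd A -> psd (B *m A *m ctr B).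
Proof. by move=> a v; rewrite qf_congr. Qed.

Lemma lew_refl n (A : 'M[C]_n) : lew A A. Proof. by move=> v. Qed.
Lemma lew_trans n (B A D : 'M[C]_n) : lew A B -> lew B D -> lew A D.
Proof. by move=> ab bd v; exact: le_trans (ab v) (bd v). Qed.

Lemma herm_form_Im n (A : 'M[C]_n) (v : 'cV[C]_n) : Defs.hermitian A ->
  complex.Im ((ctr v *m A *m v) 0 0) = 0.
Proof.
move=> hA; have : ctr (ctr v *m A *m v) = ctr v *m A *m v.
  by rewrite !ctrM ctrK hA mulmxA.
move=> /matrixP /(_ 0 0); rewrite [LHS]mxE [X in conjc X]mxE.
by case: (_ 0 0) => a b [] /= ?; lra.
Qed.

(** * Positive definite matrices, inversion and congruence *)

Lemma hpdP n (A : 'M[C]_n) :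
  hpd A <-> Defs.hermitian A /\ forall v, v != 0 -> 0 < qf A v.
Proof.
split=> -[hA H]; split=> // v v0.
  by move: (H v v0); rewrite ltcE => /andP[].
by rewrite ltcE herm_form_Im // eqxx /=; exact: H.
Qed.

Lemma hpsdP n (A : 'M[C]_n) : hpsd A <-> Defs.hermitian A /\ psd A.
Proof.
split=> -[hA H]; split=> // v.
  by move: (H v); rewrite lecE => /andP[].
by rewrite lecE herm_form_Im // eqxx /=; exact: H.
Qed.

Lemma hpd_psd n (A : 'M[C]_n) : hpd A -> psd A.
Proof.
move=> /hpdP[_ H] v; have [->|/H/ltW//] := eqVneq v 0.
by rewrite /qf mulmx0 mxE.
Qed.

Lemma hpd1D n (A : 'M[C]_n) : Defs.hermitian A -> psd A -> hpd (1%:M + A).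
Proof.
move=> hA pA; apply/hpdP; split; first exact: hermD (herm1 _) hA.
by move=> v v0; rewrite qfD ltr_pwDl // qf1_gt0.
Qed.

Lemma hpd_unit n (A : 'M[C]_n) : hpd A -> A \in unitmx.
Proof.
move=> /hpdP[hA H]; rewrite -row_free_unit; apply/inj_row_free => v vA.
apply/eqP; apply/negPn/negP => v0.
have cv0 : ctr v != 0.
  by apply: contra v0 => /eqP e; rewrite -(ctrK v) e /ctr trmx0 map_mx0.
by have := H _ cv0; rewrite /qf ctrK vA mul0mx mxE ltxx.
Qed.

Lemma hpd_lew n (A B : 'M[C]_n) : hpd A -> Defs.hermitian B -> lew A B -> hpd B.
Proof.
move=> /hpdP[_ H] hB AB; apply/hpdP; split=> // v v0.
exact: lt_le_trans (H v v0) (AB v).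
Qed.

Lemma hpdZ n (r : R) (A : 'M[C]_n) : 0 < r -> hpd A -> hpd (r%:C *: A).
Proof.
move=> r0 /hpdP[hA H]; apply/hpdP; split; first exact: hermZ.
by move=> v v0; rewrite qfZ mulr_gt0 // H.
Qed.

Lemma hpd_inv n (A : 'M[C]_n) : hpd A -> hpd (invmx A).
Proof.
move=> hA; have /hpdP[hh H] := hA; have uA := hpd_unit hA.
apply/hpdP; split; first exact: herm_inv.
move=> v v0; have -> : invmx A = ctr (invmx A) *m A *m invmx A.
  by rewrite ctr_inv hh mulVmx // mul1mx.
rewrite qf_congr'; apply: H; apply: contra v0 => /eqP e.
by rewrite -(mul1mx v) -(mulmxV uA) -mulmxA e mulmx0.
Qed.

(* Fenchel-Young inequality for the form of A, from 0 <= qf A (A^-1 v - u). *)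
Lemma qf_inv_ge n (A : 'M[C]_n) (u v : 'cV[C]_n) : hpd A ->
  complex.Re ((ctr v *m u) 0 0) *+ 2 - qf A u <= qf (invmx A) v.
Proof.
move=> hA; have uA := hpd_unit hA; have hh : ctr A = A by case: hA.
have := hpd_psd hA (invmx A *m v - u).
have -> : qf A (invmx A *m v - u) = qf (invmx A) v -
    complex.Re ((ctr v *m u) 0 0) - complex.Re ((ctr u *m v) 0 0) + qf A u.
  rewrite /qf ctrB ctrM ctr_inv hh mulmxBl (mulmxKV uA) mulmxBl !mulmxBr.
  rewrite !mulmxA -(mulmxA (ctr u) A (invmx A)) (mulmxV uA) mulmx1.
  move: (ctr v *m invmx A *m v) (ctr v *m u) (ctr u *m v) (ctr u *m A *m u).
  by move=> a b c d; rewrite !mxE !(cReD, cReN); ring.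
have -> : complex.Re ((ctr u *m v) 0 0) = complex.Re ((ctr v *m u) 0 0).
  rewrite -{1}(ctrK v) -ctrM; move: (ctr v *m u) => a.
  by rewrite !mxE; case: (a 0 0).
by move: (qf _ _) (qf _ _) (complex.Re _) => a b c; lra.
Qed.

(** The choice [u = B^-1 v] in [qf_inv_ge] turns the pairing into [qf (B^-1) v], and [A <= B] bounds
    [qf A u] by the same quantity. *)
Lemma lew_inv n (A B : 'M[C]_n) : hpd A -> hpd B -> lew A B ->
  lew (invmx B) (invmx A).
Proof.
move=> hA hB AB v; have uB := hpd_unit hB.
have hhB : ctr B = B by case: hB.
apply: le_trans (qf_inv_ge (invmx B *m v) v hA).
have eB : qf B (invmx B *m v) = qf (invmx B) v.
  by rewrite -qf_congr' ctr_inv hhB (mulVmx uB) mul1mx.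
rewrite mulmxA -/(qf (invmx B) v); have := AB (invmx B *m v); rewrite eB.
by move: (qf _ _) (qf _ _) => a b; lra.
Qed.

Lemma lew_congr m n (B : 'M[C]_(m, n)) (X Y : 'M[C]_n) :
  lew X Y -> lew (B *m X *m ctr B) (B *m Y *m ctr B).
Proof. by move=> xy v; rewrite !qf_congr. Qed.

Lemma lew_congr' m n (B : 'M[C]_(n, m)) (X Y : 'M[C]_n) :
  lew X Y -> lew (ctr B *m X *m B) (ctr B *m Y *m B).
Proof. by move=> xy v; rewrite !qf_congr'. Qed.

(** Polarization: [z = 1] and [z = i] recover the real and imaginary parts of an entry from values
    of the form. This carries equality and monotone convergence from forms to entries. *)
Lemma qf_delta2 n (A : 'M[C]_n) (a b : 'I_n) (z : C) :
  qf A (delta_mx a 0 + z *: delta_mx b 0) =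
  complex.Re (A a a + z * A a b + z^*%C * A b a + z^*%C * (z * A b b)).
Proof.
have D (i j : 'I_n) : ctr (delta_mx i 0 : 'cV[C]_n) *m A *m delta_mx j 0
    = (A i j)%:M.
  rewrite -colE [ctr _](_ : _ = delta_mx 0 i).
    by rewrite -rowE; apply/matrixP => k l; rewrite !ord1 !mxE.
  by apply/matrixP => k l; rewrite !mxE rmorph_nat andbC.
rewrite /qf ctrD [ctr (z *: _)](_ : _ = z^*%C *: ctr (delta_mx b 0)); last first.
  by rewrite /ctr linearZ /= map_mxZ.
rewrite !(mulmxDl, mulmxDr) -!(scalemxAl, scalemxAr) !D.
by rewrite !mxE !mulr1n; congr complex.Re; ring.
Qed.

Lemma qf_delta n (A : 'M[C]_n) (a : 'I_n) :
  qf A (delta_mx a 0) = complex.Re (A a a).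
Proof.
have := qf_delta2 A a a 0.
by rewrite scale0r addr0 conjc0 !mul0r !addr0.
Qed.

Lemma herm_entry n (A : 'M[C]_n) a b : Defs.hermitian A -> A b a = (A a b)^*%C.
Proof. by move=> hA; rewrite -{1}hA !mxE. Qed.

Lemma Re_entryE n (A : 'M[C]_n) a b : Defs.hermitian A ->
  complex.Re (A a b) = (qf A (delta_mx a 0 + delta_mx b 0)
     - qf A (delta_mx a 0) - qf A (delta_mx b 0)) / 2.
Proof.
move=> hA; rewrite -{1}(scale1r (delta_mx b 0)) qf_delta2 !qf_delta.
rewrite (herm_entry a b hA) conjc1 !mul1r !cReD.
by case: (A a b) => x y /=; field.
Qed.

Lemma Im_entryE n (A : 'M[C]_n) a b : Defs.hermitian A ->
  complex.Im (A a b) = (qf A (delta_mx a 0) + qf A (delta_mx b 0)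
     - qf A (delta_mx a 0 + 'i%C *: delta_mx b 0)) / 2.
Proof.
move=> hA; rewrite qf_delta2 !qf_delta (herm_entry a b hA).
case: (A a b) (A a a) (A b b) => x y [p q] [r s] /=.
by field.
Qed.

Lemma qf_inj n (A B : 'M[C]_n) : Defs.hermitian A -> Defs.hermitian B ->
  (forall v, qf A v = qf B v) -> A = B.
Proof.
move=> hA hB AB; apply/matrixP => a b; apply: complex_eqP.
  by rewrite (Re_entryE _ _ hA) (Re_entryE _ _ hB) !AB.
by rewrite (Im_entryE _ _ hA) (Im_entryE _ _ hB) !AB.
Qed.

Lemma herm_spectral n (A : 'M[C]_n) : Defs.hermitian A ->
  exists U : 'M[C]_n, exists d : 'I_n -> R,
    [/\ U *m ctr U = 1%:M, ctr U *m U = 1%:M &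
        A = ctr U *m diag_mx (\row_i (d i)%:C) *m U].
Proof.
move=> hA; have nA : A \is normalmx.
  apply/normalmxP; rewrite (_ : map_mx Num.conj A^T = A) //.
have /orthomx_spectralP e := nA.
have U1 : spectralmx A *m ctr (spectralmx A) = 1%:M.
  by have /unitarymxP := spectral_unitarymx A.
exists (spectralmx A), (fun i => complex.Re (spectral_diag A 0 i)).
have U2 : ctr (spectralmx A) *m spectralmx A = 1%:M by apply: mulmx1C.
move: e; rewrite (invmx_unitary (spectral_unitarymx A)) => e.
split; [exact: U1|exact: U2|].
rewrite {1}e; congr (_ *m diag_mx _ *m _); apply/matrixP => i j.
rewrite ord1 !mxE; symmetry.
(* The eigenvalues are real because their diagonal matrix is congruent to [A], hence Hermitian. *)
have D : diag_mx (spectral_diag A) = spectralmx A *m A *m ctr (spectralmx A).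
  by rewrite {3}e !mulmxA U1 mul1mx -mulmxA U1 mulmx1.
have : ctr (diag_mx (spectral_diag A)) = diag_mx (spectral_diag A).
  by rewrite D; apply: herm_congr.
move=> /matrixP /(_ j j); rewrite !mxE eqxx !mulr1n.
by case: (spectral_diag A 0 j) => a b [] h; apply: complex_eqP => //=; lra.
Qed.

Lemma qf_diag n (d : 'I_n -> R) v : qf (diag_mx (\row_i (d i)%:C)) v =
  \sum_i d i * (complex.Re (v i 0) ^+ 2 + complex.Im (v i 0) ^+ 2).
Proof.
rewrite /qf mxE cRe_sum; apply: eq_bigr => i _.
rewrite mul_mx_diag !mxE -cRe_conjM.
by case: (v i 0) => a b /=; ring.
Qed.

Lemma hpsd_spectral n (A : 'M[C]_n) : Defs.hermitian A -> psd A ->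
  exists U : 'M[C]_n, exists d : 'I_n -> R,
    [/\ U *m ctr U = 1%:M, ctr U *m U = 1%:M,
        A = ctr U *m diag_mx (\row_i (d i)%:C) *m U & forall i, 0 <= d i].
Proof.
move=> hA pA; have [U [d [U1 U2 e]]] := herm_spectral hA.
exists U, d; split=> // i; have := pA (ctr U *m delta_mx i 0).
rewrite e qf_congr' mulmxA U1 mul1mx qf_diag (bigD1 i) //= big1 ?addr0.
  by rewrite !mxE !eqxx /= expr0n /= expr1n addr0 mulr1.
by move=> j ji; rewrite !mxE (negbTE ji) /= expr0n /= addr0 mulr0.
Qed.

Lemma det_conj_unitary n (U D : 'M[C]_n) : U *m ctr U = 1%:M ->
  \det (ctr U *m D *m U) = \det D.
Proof.
move=> /(congr1 determinant); rewrite !det_mulmx det1 => e.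
by rewrite mulrAC [_ * \det U]mulrC e mul1r.
Qed.

Lemma det_1D_spectral n (U : 'M[C]_n) (d : 'I_n -> R) :
  U *m ctr U = 1%:M -> ctr U *m U = 1%:M ->
  \det (1%:M + ctr U *m diag_mx (\row_i (d i)%:C) *m U) = (\prod_i (1 + d i))%:C.
Proof.
move=> U1 U2; rewrite -[X in X + _]U2 -[X in X *m _ + _]mulmx1 -mulmxDl -mulmxDr.
rewrite det_conj_unitary // -diag_const_mx -raddfD /= det_diag rmorph_prod.
by apply: eq_bigr => i _; rewrite !mxE rmorphD.
Qed.

Lemma mxtrace_spectral n (U : 'M[C]_n) (d : 'I_n -> R) : U *m ctr U = 1%:M ->
  \tr (ctr U *m diag_mx (\row_i (d i)%:C) *m U) = (\sum_i d i)%:C.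
Proof.
move=> U1; rewrite mxtrace_mulC mulmxA U1 mul1mx mxtrace_diag rmorph_sum.
by apply: eq_bigr => i _; rewrite !mxE.
Qed.

(** Each eigenvalue is at most the sum of all, none being negative. The trace serves as a bound on
    the largest eigenvalue that is an explicit function of the entries. *)
Lemma lew_tr n (A : 'M[C]_n) : Defs.hermitian A -> psd A ->
  lew A ((complex.Re (\tr A))%:C *: 1%:M).
Proof.
move=> hA pA v; have [U [d [U1 U2 e d0]]] := hpsd_spectral hA pA.
rewrite qfZ {1}e qf_congr' qf_diag e mxtrace_spectral //=.
rewrite -[qf 1%:M v](_ : qf 1%:M (U *m v) = _); last first.
  by rewrite -qf_congr' mulmx1 U2.
rewrite qf1E mulr_sumr; apply: ler_sum => i _.
apply: ler_wpM2r; first by rewrite addr_ge0 // sqr_ge0.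
by rewrite (bigD1 i) //= lerDl sumr_ge0.
Qed.

(** * Logarithms of determinants *)

Lemma ln_prod (I : Type) (s : seq I) (f : I -> R) : (forall i, 0 < f i) ->
  ln (\prod_(i <- s) f i) = \sum_(i <- s) ln (f i).
Proof.
move=> f0; elim: s => [|x s IH]; first by rewrite !big_nil ln1.
by rewrite !big_cons lnM ?posrE ?IH // prodr_gt0.
Qed.

(** In an eigenbasis this is [0 <= ln (1 + d) <= d] for each eigenvalue [d]. *)
Lemma logdet_1D_le n (A : 'M[C]_n) : Defs.hermitian A -> psd A ->
  0 <= logdet (1%:M + A) <= complex.Re (\tr A).
Proof.
move=> hA pA; have [U [d [U1 U2 -> d0]]] := hpsd_spectral hA pA.
rewrite /logdet mxtrace_spectral // det_1D_spectral //=.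
have p i : 0 < 1 + d i by rewrite ltr_pwDl.
rewrite ln_prod // sumr_ge0 /=; last by move=> i _; rewrite ln_ge0 // lerDl.
by apply: ler_sum => i _; apply: le_ln1Dx; apply: lt_le_trans (d0 i).
Qed.

Lemma hpd_sqrt n (A : 'M[C]_n) : hpd A ->
  exists2 B : 'M[C]_n, B \in unitmx & A = B *m ctr B.
Proof.
move=> hA; have hh : Defs.hermitian A by case: hA.
have [U [d [U1 U2 e d0]]] := hpsd_spectral hh (hpd_psd hA).
have eq : A = (ctr U *m diag_mx (\row_i (Num.sqrt (d i))%:C)) *m
              ctr (ctr U *m diag_mx (\row_i (Num.sqrt (d i))%:C)).
  rewrite ctrM ctrK [ctr (diag_mx _)](_ : _ = diag_mx (\row_i (Num.sqrt (d i))%:C)).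
    rewrite mulmxA -(mulmxA (ctr U)) mulmx_diag e.
    congr (_ *m diag_mx _ *m _); apply/matrixP => i j; rewrite !mxE.
    by rewrite -rmorphM /= -expr2 sqr_sqrtr.
  rewrite /ctr tr_diag_mx map_diag_mx; congr diag_mx.
  by apply/matrixP => i j; rewrite !mxE; exact: conjc_real.
have := hpd_unit hA; rewrite eq => u.
by eexists; last reflexivity; move: u; rewrite unitmx_mul => /andP[].
Qed.

Lemma det_ctr n (A : 'M[C]_n) : \det (ctr A) = (\det A)^*%C.
Proof. by rewrite /ctr det_map_mx det_tr. Qed.

(** With [A = B B^*] the determinant is the squared modulus of [\det B]. This makes the real part
    and the logarithm in [logdet] harmless. *)
Lemma hpd_det n (A : 'M[C]_n) : hpd A ->
  0 < complex.Re (\det A) /\ \det A = (complex.Re (\det A))%:C.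
Proof.
move=> hA; have [B uB ->] := hpd_sqrt hA.
rewrite det_mulmx det_ctr.
have : \det B != 0 by rewrite -unitfE -unitmxE.
case: (\det B) => a b ab; rewrite mulrC cRe_conjM /=; split.
  rewrite lt_def addr_ge0 ?sqr_ge0 // andbT.
  apply: contra ab; rewrite paddr_eq0 ?sqr_ge0 // !sqrf_eq0.
  by move=> /andP[/eqP -> /eqP ->].
by apply: complex_eqP => /=; rewrite ?expr2; ring.
Qed.

Lemma logdetM m n p (A : 'M[C]_m) (B : 'M[C]_n) (D : 'M[C]_p) : hpd A -> hpd B ->
  \det D = \det A * \det B -> logdet D = logdet A + logdet B.
Proof.
move=> /hpd_det[a ea] /hpd_det[b eb]; rewrite /logdet => ->.
by rewrite ea eb -rmorphM /= lnM.
Qed.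

Lemma logdet_inv n (A : 'M[C]_n) : hpd A -> logdet (invmx A) = - logdet A.
Proof.
move=> hA; apply/eqP; rewrite -addr_eq0 addrC; apply/eqP.
rewrite -(@logdetM _ _ _ _ _ (A *m invmx A)) ?det_mulmx //; last exact: hpd_inv.
by rewrite mulmxV ?hpd_unit // /logdet det1 ln1.
Qed.

(** Writing [A = S S^*], one has [B = S (1 + M) S^*] with [M] positive semidefinite, so the
    difference of the two sides is [logdet (1 + M)]. *)
Lemma logdet_mono n (A B : 'M[C]_n) : hpd A -> Defs.hermitian B -> lew A B ->
  logdet A <= logdet B.
Proof.
move=> hA hB AB; have hhA : Defs.hermitian A by case: hA.
have hpB := hpd_lew hA hB AB; have [S uS e] := hpd_sqrt hA.
pose M := invmx S *m (B - A) *m ctr (invmx S).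
have hM : Defs.hermitian M by apply/herm_congr/hermB.
have pM : psd M by apply: psd_congr => v; rewrite qfB subr_ge0.
have uS' : ctr S \in unitmx.
  by rewrite unitmxE det_ctr unitfE conjc_eq0 -unitfE -unitmxE.
have eB : B = S *m (1%:M + M) *m ctr S.
  rewrite mulmxDr mulmx1 mulmxDl -e /M ctr_inv !mulmxA mulmxV // mul1mx.
  by rewrite mulmxKV // subrKC.
rewrite (@logdetM _ _ _ A (1%:M + M) B) //; last 2 first.
- exact: hpd1D.
- by rewrite eB e !det_mulmx mulrAC.
by rewrite lerDl; case/andP: (logdet_1D_le hM pM).
Qed.

Lemma logdetZ n (r : R) (A : 'M[C]_n) : 0 < r -> hpd A ->
  logdet (r%:C *: A) = n%:R * ln r + logdet A.
Proof.
move=> r0 /hpd_det[a ea]; rewrite /logdet detZ ea -rmorphXn -rmorphM /=.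
by rewrite lnM ?posrE ?exprn_gt0 // lnXn // mulr_natl.
Qed.

End ConjTranspose.

(** * The recursion map and its contraction *)

Section Recursion.
Variables (R : realType) (N K : nat) (rho : R).
Hypothesis rho0 : 0 < rho.
Local Notation C := R[i].
Local Notation "r %:C" := (real_complex R r).
Implicit Types (F G : 'M[C]_(N, K)) (X Y : 'M[C]_K).

(** The step inverts two matrices: the inner one is [AF], whose [logdet] is [ldF], and the outer one
    is [1 + SG]. *)
Definition AF F X : 'M[C]_N := 1%:M + rho%:C *: (F *m X *m ctr F).
Definition SG F G X : 'M[C]_K := rho%:C *: (ctr G *m invmx (AF F X) *m G).

Definition frob2 m n (M : 'M[C]_(m, n)) : R :=
  \sum_i \sum_j (complex.Re (M i j) ^+ 2 + complex.Im (M i j) ^+ 2).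

Lemma frob2_ge0 m n (M : 'M[C]_(m, n)) : 0 <= frob2 M.
Proof.
by apply: sumr_ge0 => i _; apply: sumr_ge0 => j _; rewrite addr_ge0 // sqr_ge0.
Qed.

Lemma frob2E m n (M : 'M[C]_(m, n)) : complex.Re (\tr (M *m ctr M)) = frob2 M.
Proof.
rewrite /mxtrace cRe_sum; apply: eq_bigr => i _; rewrite mxE cRe_sum.
by apply: eq_bigr => j _; rewrite !mxE mulrC cRe_conjM.
Qed.

Definition gain G : R := rho * frob2 G.

Lemma gain_ge0 G : 0 <= gain G.
Proof. by rewrite mulr_ge0 ?frob2_ge0 // ltW. Qed.

Lemma WstepE F G X : Wstep rho F G X = invmx (1%:M + SG F G X).
Proof. by []. Qed.

Lemma hpsd1 n : hpsd (1%:M : 'M[C]_n).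
Proof. by apply/hpsdP; split; [exact: herm1|exact: psd1]. Qed.

Lemma hpd_hpsd n (A : 'M[C]_n) : hpd A -> hpsd A.
Proof. by move=> hA; apply/hpsdP; split; [case: hA|exact: hpd_psd]. Qed.

Lemma hpsd_congr m n (B : 'M[C]_(m, n)) (A : 'M[C]_n) :
  hpsd A -> hpsd (B *m A *m ctr B).
Proof.
move=> /hpsdP[hA pA]; apply/hpsdP; split; first exact: herm_congr.
exact: psd_congr.
Qed.

Lemma hpsdZ n (r : R) (A : 'M[C]_n) : 0 <= r -> hpsd A -> hpsd (r%:C *: A).
Proof.
by move=> r0 /hpsdP[hA pA]; apply/hpsdP; split; [exact: hermZ|exact: psdZ].
Qed.

Lemma hpsd_hpd1D n (A : 'M[C]_n) : hpsd A -> hpd (1%:M + A).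
Proof. by move=> /hpsdP[hA pA]; exact: hpd1D. Qed.

Lemma hpd1 n : hpd (1%:M : 'M[C]_n).
Proof. by have := hpd1D (@herm0 R n) (@psd0 R n); rewrite addr0. Qed.

Lemma AF_hpd F X : hpsd X -> hpd (AF F X).
Proof. by move=> hX; apply/hpsd_hpd1D/hpsdZ/hpsd_congr => //; exact: ltW. Qed.

Lemma SG_hpsd F G X : hpsd X -> hpsd (SG F G X).
Proof.
move=> hX; apply: hpsdZ; first exact: ltW.
rewrite -{2}(ctrK G); apply/hpsd_congr/hpd_hpsd/hpd_inv.
exact: AF_hpd.
Qed.

Lemma SG1_hpd F G X : hpsd X -> hpd (1%:M + SG F G X).
Proof. by move=> hX; apply/hpsd_hpd1D/SG_hpsd. Qed.

Lemma Wstep_hpd F G X : hpsd X -> hpd (Wstep rho F G X).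
Proof. by move=> hX; apply/hpd_inv/SG1_hpd. Qed.

Lemma Wstep_hpsd F G X : hpsd X -> hpsd (Wstep rho F G X).
Proof. by move=> hX; apply/hpd_hpsd/Wstep_hpd. Qed.

Lemma invmx_scaleC n (r : R) (A : 'M[C]_n) : r != 0 -> A \in unitmx ->
  invmx (r%:C *: A) = (r^-1)%:C *: invmx A.
Proof.
move=> r0 uA; rewrite invmxZ; last first.
  by rewrite unitmxZ // unitfE fmorph_eq0.
by rewrite fmorphV.
Qed.

Lemma lew_add2l n (D A B : 'M[C]_n) : lew A B -> lew (D + A) (D + B).
Proof. by move=> AB v; rewrite !qfD lerD2l; exact: AB. Qed.

Lemma lew_addr n (A B : 'M[C]_n) : hpsd B -> lew A (A + B).
Proof. by move=> /hpsdP[_ pB] v; rewrite qfD lerDl; exact: pB. Qed.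

Lemma lew_scale n (r : R) (A B : 'M[C]_n) : 0 <= r -> lew A B ->
  lew (r%:C *: A) (r%:C *: B).
Proof. by move=> r0 AB v; rewrite !qfZ ler_wpM2l //; exact: AB. Qed.

Lemma lew_unscale n (r : R) (A B : 'M[C]_n) : 0 < r ->
  lew ((r^-1)%:C *: A) B -> lew A (r%:C *: B).
Proof. by move=> r0 AB v; have := AB v; rewrite !qfZ ler_pdivrMl. Qed.

Lemma lew_inv_scale n (r : R) (A B : 'M[C]_n) : 0 < r -> hpd A -> hpd B ->
  lew A (r%:C *: B) -> lew (invmx B) (r%:C *: invmx A).
Proof.
move=> r0 hA hB AB; apply: (lew_unscale r0).
have r1 : r != 0 by rewrite gt_eqF.
rewrite -(invmx_scaleC r1 (hpd_unit hB)).
exact: (lew_inv hA (hpdZ r0 hB) AB).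
Qed.

(** * Monotonicity and contraction of the step *)

Lemma AF_mono F X Y : lew X Y -> lew (AF F X) (AF F Y).
Proof. by move=> XY; apply/lew_add2l/lew_scale/lew_congr => //; exact: ltW. Qed.

Lemma AF_ge1 F X : hpsd X -> lew 1%:M (AF F X).
Proof. by move=> hX; apply/lew_addr/hpsdZ/hpsd_congr => //; exact: ltW. Qed.

Lemma AFV_le1 F X : hpsd X -> lew (invmx (AF F X)) 1%:M.
Proof.
move=> hX; rewrite -[X in lew _ X](invmx1 _ N).
by apply: lew_inv; [exact: hpd1|exact: AF_hpd|exact: AF_ge1].
Qed.

(** Only [A] is dilated in [1 + A], not the identity, and [A <= a] limits its share of [1 + A] to
    [a / (1 + a)]; the excess [e] shrinks by that share. *)
Lemma lew_1D_scaled n (A B : 'M[C]_n) (a e : R) : 0 <= a -> 0 <= e -> psd A ->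
  lew A (a%:C *: 1%:M) -> lew A ((1 + e)%:C *: B) ->
  lew (1%:M + A) ((1 + a / (1 + a) * e)%:C *: (1%:M + B)).
Proof.
move=> a0 e0 pA Aa AB v; rewrite qfZ !qfD.
have a1 : 0 < 1 + a by rewrite ltr_pwDl.
have e1 : 0 < 1 + e by rewrite ltr_pwDl.
have sa := Aa v; rewrite qfZ in sa.
have st := AB v; rewrite qfZ in st.
have s0 := pA v; have n0 := qf1_ge0 v.
move: sa s0 n0 st; set s := qf A v; set t := qf B v.
set m := qf _ v => sa s0 n0 st.
have : s / (1 + e) <= t by rewrite ler_pdivrMr // mulrC.
have k1 : 0 <= 1 + a / (1 + a) * e.
  by rewrite addr_ge0 // mulr_ge0 // divr_ge0 // ltW.
move=> /(lerD (lexx m))/(ler_wpM2l k1); apply: le_trans.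
(* With [t] replaced by its lower bound [s / (1 + e)], the claim becomes the sign of an explicit
   fraction, which follows from [s <= a m <= a (1 + e) m]. *)
rewrite -subr_ge0.
have -> : (1 + a / (1 + a) * e) * (m + s / (1 + e)) - (m + s) =
   e * (a * (1 + e) * m - s) / ((1 + a) * (1 + e)).
  by field; rewrite !gt_eqF.
apply: divr_ge0; last by rewrite mulr_ge0 // ltW.
rewrite mulr_ge0 // subr_ge0 (le_trans sa) // -mulrA ler_wpM2l //.
by rewrite ler_peMl // lerDl.
Qed.

(** Each of the two inversions reverses the order. *)
Lemma Wstep_mono F G X Y : hpsd X -> hpsd Y -> lew X Y ->
  lew (Wstep rho F G X) (Wstep rho F G Y).
Proof.
move=> hX hY XY; rewrite !WstepE.
apply: lew_inv; [exact: SG1_hpd..|].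
apply/lew_add2l/lew_scale/lew_congr'; first exact: ltW.
by apply: lew_inv; [exact: AF_hpd..|exact: AF_mono].
Qed.

Lemma ctrM_hpsd m n (B : 'M[C]_(m, n)) : hpsd (ctr B *m B).
Proof.
by have := hpsd_congr (ctr B) (@hpsd1 m); rewrite mulmx1 ctrK.
Qed.

Lemma SG_le F G X : hpsd X -> lew (SG F G X) (rho%:C *: (ctr G *m G)).
Proof.
move=> hX; apply: lew_scale; first exact: ltW.
by rewrite -[X in lew _ (X *m _)]mulmx1; exact/lew_congr'/AFV_le1.
Qed.

Lemma SG_le_gain F G X : hpsd X -> lew (SG F G X) ((gain G)%:C *: 1%:M).
Proof.
move=> hX; apply: lew_trans (SG_le F G hX) _.
have /hpsdP[hh pp] := ctrM_hpsd G.
have := lew_scale (ltW rho0) (lew_tr hh pp).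
by rewrite mxtrace_mulC frob2E scalerA -rmorphM.
Qed.

Lemma Wstep_le1 F G X : hpsd X -> lew (Wstep rho F G X) 1%:M.
Proof.
move=> hX; rewrite WstepE -[X in lew _ X](invmx1 _ K).
by apply: lew_inv; [exact: hpd1|exact: SG1_hpd|exact/lew_addr/SG_hpsd].
Qed.

Lemma lew_1D_1 n (A : 'M[C]_n) (a : R) : lew A (a%:C *: 1%:M) ->
  lew (1%:M + A) ((1 + a)%:C *: 1%:M).
Proof. by move=> Aa; rewrite rmorphD scalerDl scale1r; exact: lew_add2l. Qed.

(** Together with [Wstep_le1], this compares any two outputs of the same step up to the factor
    [1 + gain G], whatever the inputs; every contraction argument starts here. *)
Lemma Wstep_ge F G X : hpsd X ->
  lew 1%:M ((1 + gain G)%:C *: Wstep rho F G X).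
Proof.
move=> hX; have a0 : 0 < 1 + gain G by rewrite ltr_pwDl // gain_ge0.
rewrite WstepE -[X in lew X _](invmx1 _ K).
apply: lew_inv_scale => //; [exact: SG1_hpd|exact: hpd1|].
exact/lew_1D_1/SG_le_gain.
Qed.

Definition kap G : R := gain G / (1 + gain G).

Lemma kap_ge0 G : 0 <= kap G.
Proof. by rewrite divr_ge0 ?gain_ge0 // addr_ge0 // gain_ge0. Qed.

Lemma lew_1D_dilate n (A : 'M[C]_n) (e : R) : 0 <= e ->
  lew (1%:M + (1 + e)%:C *: A) ((1 + e)%:C *: (1%:M + A)).
Proof.
move=> e0 v; rewrite qfZ !qfD qfZ.
by rewrite mulrDr lerD2r ler_peMl ?qf1_ge0 // lerDl.
Qed.

Lemma lew_AF F X Y (e : R) : hpsd X -> 0 <= e ->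
  lew Y ((1 + e)%:C *: X) -> lew (AF F Y) ((1 + e)%:C *: AF F X).
Proof.
move=> hX e0 YX; have e1 : 0 <= 1 + e by rewrite addr_ge0.
apply: lew_trans (AF_mono F YX) _.
have -> : AF F ((1 + e)%:C *: X) =
    1%:M + (1 + e)%:C *: (rho%:C *: (F *m X *m ctr F)).
  by rewrite /AF -scalemxAr -scalemxAl [in LHS]scalerA mulrC -scalerA.
exact: lew_1D_dilate.
Qed.

(** The inner matrix merely preserves the factor [1 + e], as no bound on [F X F^*] is available. The
    improvement comes from the outer identity, since [SG] is bounded by [gain G] uniformly in [F]
    and [X]. *)
Lemma Wstep_contract F G X Y (e : R) : hpsd X -> hpsd Y -> 0 <= e ->
  lew Y ((1 + e)%:C *: X) ->
  lew (Wstep rho F G Y) ((1 + kap G * e)%:C *: Wstep rho F G X).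
Proof.
move=> hX hY e0 YX; have e1 : 0 < 1 + e by rewrite ltr_pwDl.
have k1 : 0 < 1 + kap G * e by rewrite ltr_pwDl // mulr_ge0 // kap_ge0.
rewrite !WstepE; apply: (lew_inv_scale k1 (SG1_hpd F G hX) (SG1_hpd F G hY)).
have /hpsdP[_ pS] := SG_hpsd F G hX.
apply: (lew_1D_scaled (gain_ge0 G) e0 pS (SG_le_gain F G hX)).
have -> : (1 + e)%:C *: SG F G Y =
    rho%:C *: (ctr G *m ((1 + e)%:C *: invmx (AF F Y)) *m G).
  by rewrite /SG -scalemxAr -scalemxAl scalerA mulrC -scalerA.
apply/lew_scale/lew_congr'; first exact: ltW.
exact: (lew_inv_scale e1 (AF_hpd F hY) (AF_hpd F hX) (lew_AF F hX e0 YX)).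
Qed.

(** * Bounds and comparison for the terms of one step *)

Lemma logdet_1D_hpsd n (A : 'M[C]_n) : hpsd A ->
  0 <= logdet (1%:M + A) <= complex.Re (\tr A).
Proof. by move=> /hpsdP[hh pp]; exact: logdet_1D_le. Qed.

(** Comparison with [X = 1], then the trace bound. The upper bound is free of [X], so it dominates
    all trajectories below the identity at once. *)
Lemma ldF_bounds F X : hpsd X -> lew X 1%:M -> 0 <= ldF rho F X <= rho * frob2 F.
Proof.
move=> hX X1; have hAF : hpsd (rho%:C *: (F *m X *m ctr F)).
  by apply/hpsdZ/hpsd_congr => //; exact: ltW.
have /andP[-> _] := logdet_1D_hpsd hAF; rewrite /=.
have hFF : hpsd (rho%:C *: (F *m 1%:M *m ctr F)).
  by apply/hpsdZ/hpsd_congr/hpsd1; exact: ltW.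
apply: (@le_trans _ _ (logdet (AF F 1%:M))).
  apply: logdet_mono; [exact: AF_hpd| |exact: AF_mono].
  by case: (hpsd_hpd1D hFF).
have /andP[_ trF] := logdet_1D_hpsd hFF; apply: le_trans trF _.
by rewrite mulmx1 mxtraceZ cReZ frob2E.
Qed.

Lemma logdet_Wstep F G X : hpsd X ->
  logdet (Wstep rho F G X) = - logdet (1%:M + SG F G X).
Proof. by move=> hX; rewrite WstepE logdet_inv //; exact: SG1_hpd. Qed.

Lemma logdet_Wstep_bounds F G X : hpsd X ->
  0 <= - logdet (Wstep rho F G X) <= rho * frob2 G.
Proof.
move=> hX; rewrite logdet_Wstep // opprK.
have /andP[-> _] := logdet_1D_hpsd (SG_hpsd F G hX); rewrite /=.
have hG := hpsdZ (ltW rho0) (ctrM_hpsd G).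
apply: (@le_trans _ _ (logdet (1%:M + rho%:C *: (ctr G *m G)))).
  apply: logdet_mono; [exact: SG1_hpd| |exact/lew_add2l/SG_le].
  by case: (hpsd_hpd1D hG).
have /andP[_ trG] := logdet_1D_hpsd hG; apply: le_trans trG _.
by rewrite mxtraceZ cReZ mxtrace_mulC frob2E.
Qed.

Lemma logdet_ratio n (A B : 'M[C]_n) (e : R) : hpd A -> hpd B -> 0 <= e ->
  lew B ((1 + e)%:C *: A) -> logdet B <= logdet A + n%:R * ln (1 + e).
Proof.
move=> hA hB e0 BA; have e1 : 0 < 1 + e by rewrite ltr_pwDl.
rewrite addrC -logdetZ //; apply: logdet_mono => //.
by case: (hpdZ e1 hA).
Qed.

Lemma ldF_ratio F X Y (e : R) : hpsd X -> hpsd Y -> 0 <= e ->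
  lew Y ((1 + e)%:C *: X) -> ldF rho F Y <= ldF rho F X + N%:R * ln (1 + e).
Proof.
move=> hX hY e0 YX; apply: logdet_ratio => //; [exact: AF_hpd..|].
exact: lew_AF.
Qed.

End Recursion.

(** * The determinant of the block bidiagonal channel *)

Section DetFormula.
Variables (R : realType) (N K : nat) (rho : R).
Hypothesis rho0 : 0 < rho.
Local Notation C := R[i].
Local Notation "r %:C" := (real_complex R r).

Lemma ctr0 m n : ctr (0 : 'M[C]_(m, n)) = 0.
Proof. by rewrite /ctr trmx0 map_mx0. Qed.

Lemma ctr_block_mx m1 m2 n1 n2 (A : 'M[C]_(m1, n1)) (B : 'M[C]_(m1, n2))
    (D : 'M[C]_(m2, n1)) (E : 'M[C]_(m2, n2)) :
  ctr (block_mx A B D E) = block_mx (ctr A) (ctr D) (ctr B) (ctr E).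
Proof. by rewrite /ctr tr_block_mx map_block_mx. Qed.

Lemma ctr_row_mx m n1 n2 (A : 'M[C]_(m, n1)) (B : 'M[C]_(m, n2)) :
  ctr (row_mx A B) = col_mx (ctr A) (ctr B).
Proof. by rewrite /ctr tr_row_mx map_col_mx. Qed.

Lemma ctr_col_mx m1 m2 n (A : 'M[C]_(m1, n)) (B : 'M[C]_(m2, n)) :
  ctr (col_mx A B) = row_mx (ctr A) (ctr B).
Proof. by rewrite /ctr tr_col_mx map_row_mx. Qed.

Lemma hpsd_block_diag m n (A : 'M[C]_m) :
  hpsd A -> hpsd (block_mx A 0 0 (1%:M : 'M[C]_n)).
Proof.
move=> /hpsdP[hh pp]; apply/hpsdP; split.
  by rewrite /Defs.hermitian ctr_block_mx hh !ctr0 ctr1.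
move=> v; rewrite -[v]vsubmxK /qf ctr_col_mx.
rewrite mul_row_block mul_row_col !mulmx0 addr0 add0r mxE cReD.
by apply: addr_ge0; [exact: pp|exact: psd1].
Qed.

Lemma det_schur m n (A : 'M[C]_m) (B : 'M[C]_(m, n)) (D : 'M[C]_(n, m))
    (E : 'M[C]_n) : A \in unitmx ->
  \det (block_mx A B D E) = \det A * \det (E - D *m invmx A *m B).
Proof.
move=> uA.
have -> : block_mx A B D E = block_mx 1%:M 0 (D *m invmx A) 1%:M *m
    block_mx A B 0 (E - D *m invmx A *m B).
  rewrite mulmx_block !(mul1mx, mul0mx, mulmx0, addr0).
  by rewrite (mulmxKV uA) [_ *m B + _]addrC subrK.
by rewrite det_mulmx det_lblock det_ublock !det1 !mul1r.
Qed.

(** Both sides are the determinant of one block matrix, factored in two ways. *)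
Lemma det_sylvester m n (A : 'M[C]_(m, n)) (B : 'M[C]_(n, m)) :
  \det (1%:M + A *m B) = \det (1%:M + B *m A).
Proof.
have e : \det (block_mx 1%:M (- A) B 1%:M) = \det (1%:M + B *m A).
  by rewrite det_schur ?unitmx1 // invmx1 mulmx1 mulmxN opprK det1 mul1r.
rewrite -e; have -> : block_mx 1%:M (- A) B 1%:M =
    block_mx (1%:M + A *m B) (- A) 0 1%:M *m block_mx 1%:M 0 B 1%:M.
  rewrite mulmx_block !(mulmx1, mul1mx, mul0mx, mulmx0, add0r).
  by rewrite mulNmx addrK.
by rewrite det_mulmx det_ublock det_lblock !det1 !mulr1.
Qed.

(** [T] names the updated matrix [A + r D B], so that the lemma applies directly with
    [T = innov]. *)
Lemma woodbury m n (A T : 'M[C]_m) (B : 'M[C]_(n, m)) (D : 'M[C]_(m, n)) (r : C) :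
  A \in unitmx -> T \in unitmx -> 1%:M + r *: (B *m invmx A *m D) \in unitmx ->
  T = A + D *m (r *: B) ->
  invmx (1%:M + r *: (B *m invmx A *m D)) = 1%:M - r *: (B *m invmx T *m D).
Proof.
move=> uA uT uS eT.
apply: (can_inj (mulmxK uS)); rewrite mulVmx //.
rewrite mulmxDr mulmx1 mulmxBl mul1mx.
have -> : r *: (B *m invmx T *m D) *m (r *: (B *m invmx A *m D)) =
    r *: (B *m invmx A *m D) - r *: (B *m invmx T *m D).
  rewrite -scalemxAl -scalerBr; congr (_ *: _).
  (* The resolvent identity: [T^-1 (T - A) A^-1 = A^-1 - T^-1]. *)
  transitivity (B *m invmx T *m (T - A) *m invmx A *m D).
    have -> : T - A = D *m (r *: B) by rewrite eT addrC addKr.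
    by rewrite -!(scalemxAl, scalemxAr) !mulmxA.
  by rewrite mulmxBr !mulmxBl (mulmxKV uT) (mulmxK uA).
by rewrite subKr subrK.
Qed.

Variables (F G : 'M[C]_(N, K)) (X : 'M[C]_K).
Hypothesis hX : hpsd X.

(** In Kalman filtering terms, when [X] is the error covariance of the previous input given the
    past, this is [rho] times the covariance of the innovation of the current output. *)
Definition innov : 'M[C]_N := AF rho F X + rho%:C *: (G *m ctr G).

Lemma innov_hpd : hpd innov.
Proof.
have hG : hpsd (rho%:C *: (G *m ctr G)).
  by rewrite -[G in G *m _]mulmx1; apply/hpsdZ/hpsd_congr/hpsd1; exact: ltW.
apply: (hpd_lew (AF_hpd rho0 F hX)); last exact: lew_addr.
by apply: hermD; [case: (AF_hpd rho0 F hX)|case: hG].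
Qed.

(** The Kalman form of the step: the prior covariance 1 of the current input minus what the output
    reveals. This is the form that a Schur complement produces. *)
Lemma Wstep_woodbury :
  Wstep rho F G X = 1%:M - rho%:C *: (ctr G *m invmx innov *m G).
Proof.
rewrite WstepE; apply: woodbury.
- exact: (hpd_unit (AF_hpd rho0 F hX)).
- exact: (hpd_unit innov_hpd).
- exact: (hpd_unit (SG1_hpd rho0 F G hX)).
- by rewrite -scalemxAr.
Qed.

(** Factoring [AF] out of [innov] leaves an [N x N] determinant, which Sylvester's identity turns
    into the [K x K] determinant of [1 + SG]. *)
Lemma logdet_innov :
  logdet innov = ldF rho F X - logdet (Wstep rho F G X).
Proof.
have uA := hpd_unit (AF_hpd rho0 F hX).
rewrite logdet_Wstep // opprK.
apply: (logdetM (AF_hpd rho0 F hX) (SG1_hpd rho0 F G hX)).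
have -> : innov = AF rho F X *m
    (1%:M + (rho%:C *: (invmx (AF rho F X) *m G)) *m ctr G).
  rewrite mulmxDr mulmx1 -scalemxAl -scalemxAr !mulmxA mulmxV //.
  by rewrite mul1mx.
rewrite det_mulmx; congr (_ * _); rewrite det_sylvester; congr (\det (_ + _)).
by rewrite -scalemxAr mulmxA.
Qed.

(** The weight [block_mx X 0 0 1] makes the induction close: [H] meets the first block row only
    through the [K] columns of [G], and eliminating that row replaces the weight 1 on these columns
    by [Wstep rho F G X]. *)
Lemma logdet_schur q m (H : 'M[C]_(q, K + m)) :
  let B := block_mx F (row_mx G 0) 0 H in
  logdet (1%:M + rho%:C *: (B *m block_mx X 0 0 1%:M *m ctr B)) =
  logdet innov + logdet (1%:M + rho%:C *:
     (H *m block_mx (Wstep rho F G X) 0 0 1%:M *m ctr H)).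
Proof.
move=> B; have uT := hpd_unit innov_hpd.
apply: logdetM; first exact: innov_hpd.
  apply/hpsd_hpd1D/hpsdZ/hpsd_congr; first exact: ltW.
  exact/hpsd_block_diag/Wstep_hpsd.
set P := row_mx G 0 : 'M[C]_(N, K + m).
have eB : B *m block_mx X 0 0 1%:M *m ctr B =
    block_mx (F *m X *m ctr F + G *m ctr G) (P *m ctr H)
      (H *m ctr P) (H *m ctr H).
  rewrite /B ctr_block_mx !ctr0.
  rewrite !mulmx_block !(mulmx0, mul0mx, addr0, add0r, mulmx1).
  congr (block_mx (_ + _) _ _ _).
  by rewrite /P ctr_row_mx mul_row_col mul0mx addr0.
rewrite eB (scalar_mx_block N q) scale_block_mx add_block_mx !add0r.
have -> : 1%:M + rho%:C *: (F *m X *m ctr F + G *m ctr G) = innov.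
  by rewrite scalerDr addrA.
rewrite det_schur //; congr (_ * \det _); rewrite -addrA; congr (_ + _).
(* By [Wstep_woodbury], the Schur correction is exactly this change of weight. *)
have -> : block_mx (Wstep rho F G X) 0 0 1%:M =
    1%:M - rho%:C *: (ctr P *m invmx innov *m P) :> 'M[C]_(K + m).
  rewrite Wstep_woodbury /P ctr_row_mx ctr0.
  rewrite mul_col_mx mul_col_row !mul0mx !mulmx0.
  rewrite scale_block_mx !scaler0 opp_block_mx !oppr0.
  by rewrite scalar_mx_block add_block_mx !addr0.
rewrite mulmxBr mulmxBl mulmx1 scalerBr; congr (_ - _).
by rewrite -!(scalemxAl, scalemxAr) !mulmxA.
Qed.

End DetFormula.

(** * Log-determinant of the channel as a sum over time steps *)

Section HmatFormula.
Variables (R : realType) (N K : nat) (rho : R).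
Hypothesis rho0 : 0 < rho.
Local Notation C := R[i].
Local Notation "r %:C" := (real_complex R r).
Implicit Types (F G : int -> 'M[C]_(N, K)).

Definition shift1 (T : Type) (f : int -> T) : int -> T := fun k => f (k + 1).

(** The type annotations use that [L.+1 * N] is convertible to [N + L * N], so no dimension cast is
    needed. The lower right block is the same matrix for the channel advanced by one. *)
Lemma Hmat_block F G L :
  (Hmat F G 0 L.+1 : 'M[C]_(N + L * N, K + (K + L * K))) =
  block_mx (F 0) (row_mx (G 0) 0) 0
    (Hmat (shift1 F) (shift1 G) 0 L : 'M[C]_(L * N, K + L * K)).
Proof.
have dr (q : nat) (a : nat) : (0 < q)%N -> ((q + a) %/ q = (a %/ q).+1)%N.
  by move=> q0; rewrite -{1}(mul1n q) divnMDl.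
apply/matrixP => i j; rewrite -(fintype.splitK i) -(fintype.splitK j).
case: (fintype.split i) => {}i; case: (fintype.split j) => {}j; rewrite /=.
- rewrite block_mxEul [LHS]mxE /= !divn_small //=.
  by rewrite addr0; congr (F 0 _ _); apply: val_inj; rewrite /= modn_small.
(* The index [j] ranges over a type that would be empty for [K = 0]. *)
- have K0 : (0 < K)%N by move: (j); case: K => // -[]; rewrite muln0.
  rewrite block_mxEur [LHS]mxE /= (dr _ _ K0) [(i %/ N)%N]divn_small //=.
  rewrite eqSS -[X in row_mx _ _ i X](fintype.splitK j).
  rewrite -[in LHS](fintype.splitK j); case: (fintype.split j) => {}j /=.
    rewrite row_mxEl divn_small //= addr0.
    by congr (G 0 _ _); apply: val_inj; rewrite /= ?modnDl modn_small.
  by rewrite row_mxEr mxE (dr _ _ K0).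
- have N0 : (0 < N)%N by move: (i); case: N => // -[]; rewrite muln0.
  rewrite block_mxEdl [LHS]mxE [RHS]mxE /= (dr _ _ N0).
  by rewrite [(j %/ K)%N]divn_small.
rewrite block_mxEdr [LHS]mxE [RHS]mxE /=.
have K0 : (0 < K)%N by move: (j); case: K => // -[]; rewrite muln0.
have N0 : (0 < N)%N by move: (i); case: N => // -[]; rewrite muln0.
rewrite (dr _ _ K0) (dr _ _ N0) eqSS.
have ei : Ordinal (mod_lt_ord (rshift N i : 'I_(L.+1 * N))) =
    Ordinal (mod_lt_ord i) by apply: val_inj; rewrite /= modnDl.
have ej : Ordinal (mod_lt_ord (rshift K j : 'I_(L.+2 * K))) =
    Ordinal (mod_lt_ord (j : 'I_(L.+1 * K))) by apply: val_inj; rewrite /= modnDl.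
rewrite ei ej /shift1 !add0r.
by have -> : Posz (i %/ N).+1 = (i %/ N)%:Z + 1 by rewrite -addn1 PoszD.
Qed.

Lemma Xrec_shift F G X n :
  Xrec rho F G X n.+1 =
  Xrec rho (shift1 F) (shift1 G) (Wstep rho (F 0) (G 0) X) n.
Proof.
elim: n => [//|n IH]; rewrite [LHS]/= -[X in Wstep _ _ _ X]/(Xrec rho F G X n.+1).
rewrite IH /= /shift1.
by have -> : Posz n.+1 = n%:Z + 1 by rewrite -addn1 PoszD.
Qed.

(** The initial matrix is arbitrary because eliminating one block row passes from [X] to the next
    value of the recursion. *)
Lemma logdet_Hmat_gen F G L X : hpsd X ->
  let H := Hmat F G 0 L : 'M[C]_(L * N, K + L * K) in
  logdet (1%:M + rho%:C *: (H *m block_mx X 0 0 1%:M *m ctr H)) =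
  \sum_(l < L) (ldF rho (F l%:Z) (Xrec rho F G X l)
                - logdet (Xrec rho F G X l.+1)).
Proof.
elim: L F G X => [|L IH] F G X hX H.
  by rewrite big_ord0 /logdet det_mx00 /= ln1.
rewrite big_ord_recl /H Hmat_block.
(* Only the type changes: the dimension [L.+1 * K] is reread as [K + L * K], the shape expected by
   [logdet_schur]. *)
have -> : block_mx X 0 0 1%:M = block_mx X 0 0 1%:M :> 'M[C]_(K + (K + L * K)).
  by [].
rewrite logdet_schur // logdet_innov //; congr (_ + _).
rewrite IH; last exact: Wstep_hpsd.
apply: eq_bigr => l _; rewrite -!Xrec_shift /shift1 -PoszD addn1.
by have -> : nat_of_ord (lift ord0 l) = l.+1 by [].
Qed.

Lemma logdet_Hmat F G L :
  logdet (1%:M + rho%:C *: (Hmat F G 0 L *m ctr (Hmat F G 0 L))) =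
  \sum_(l < L) (ldF rho (F l%:Z) (Xrec rho F G 1%:M l)
                - logdet (Xrec rho F G 1%:M l.+1)).
Proof.
have := @logdet_Hmat_gen F G L 1%:M (@hpsd1 R K).
by rewrite /= -scalar_mx_block mulmx1.
Qed.

End HmatFormula.

(** * Birkhoff's ergodic theorem *)

Lemma exists_nat_gt (R : realType) (x : R) : exists k : nat, x < k%:R.
Proof.
by exists (Num.bound `|x|); apply: le_lt_trans (ler_norm _) (archi_boundP _).
Qed.

Section Birkhoff.
Context d (T : measurableType d) (R : realType) (Q : probability T R).
Variable th : T -> T.
Hypothesis mth : measurable_fun setT th.
Hypothesis Qth : forall A, measurable A -> Q (th @^-1` A) = Q A.
Hypothesis erg : forall A, measurable A -> th @^-1` A = A ->
  Q A = 0%E \/ Q A = 1%E.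

Lemma ge0_integral_mp (f : T -> R) : measurable_fun setT f ->
  (forall x, 0 <= f x) ->
  (\int[Q]_x (f (th x))%:E = \int[Q]_x (f x)%:E)%E.
Proof.
move=> mf f0; have mef : measurable_fun setT (EFin \o f) by exact/measurable_EFinP.
have := @ge0_integral_pushforward _ _ _ _ R th mth Q setT (EFin \o f)
  measurableT mef.
rewrite preimage_setT => <-; last by move=> x _; rewrite lee_fin.
by apply: eq_measure_integral => A mA _; exact: Qth.
Qed.

Definition bsum (g : T -> R) (n : nat) (x : T) : R :=
  \sum_(k < n) g (iter k th x).

(* bmax g n is the maximum of bsum g k over k <= n. *)
Fixpoint bmax (g : T -> R) (n : nat) (x : T) : R :=
  if n is n'.+1 then Num.max 0 (g x + bmax g n' (th x)) else 0.

Lemma bsumS g n x : bsum g n.+1 x = g x + bsum g n (th x).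
Proof.
rewrite /bsum big_ord_recl; congr (_ + _).
by apply: eq_bigr => k _; rewrite -iterSr.
Qed.

Lemma bmax_ge0 g n x : 0 <= bmax g n x.
Proof. by case: n => [//|n] /=; rewrite le_max lexx. Qed.

Lemma bmax_leS g n x : bmax g n x <= bmax g n.+1 x.
Proof.
elim: n x => [|n IH] x; first by rewrite [leRHS]/= le_max lexx.
rewrite [leLHS]/= [leRHS]/=.
by apply: le_max2 => //; rewrite lerD2l; exact: IH.
Qed.

Lemma bmax_mono g x m n : (m <= n)%N -> bmax g m x <= bmax g n x.
Proof.
move=> /subnK <-; elim: (n - m)%N => [//|k IH]; rewrite addSn.
exact: le_trans IH (bmax_leS _ _ _).
Qed.

Lemma bsum_le_bmax g n x : bsum g n x <= bmax g n x.
Proof.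
elim: n x => [|n IH] x; first by rewrite /bsum big_ord0.
by rewrite bsumS /= le_max lerD2l IH orbT.
Qed.

Variable g : T -> R.
Hypothesis ig : Q.-integrable setT (EFin \o g).

Let mg : measurable_fun setT g.
Proof. by apply/measurable_EFinP; exact: measurable_int ig. Qed.

Lemma measurable_bmax n : measurable_fun setT (bmax g n).
Proof.
elim: n => [|n IH] /=; first exact: measurable_cst.
apply: measurable_maxr; first exact: measurable_cst.
by apply: measurable_funD => //; exact: measurableT_comp.
Qed.

Lemma integral_bmax_fin n : (\int[Q]_x (bmax g n x)%:E < +oo)%E.
Proof.
have ag : (\int[Q]_x (`|g x|%:E) < +oo)%E.
  by have /integrableP[_] := ig.
have mag : measurable_fun setT (fun x => `|g x|) by exact: measurableT_comp.
elim: n => [|n IH]; first by rewrite integral0_eq.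
apply: (@le_lt_trans _ _ (\int[Q]_x (`|g x| + bmax g n (th x))%:E)%E).
  apply: ge0_le_integral => //.
  - by move=> x _; rewrite lee_fin bmax_ge0.
  - exact/measurable_EFinP/measurable_bmax.
  - apply/measurable_EFinP/measurable_funD => //.
    exact: measurableT_comp (measurable_bmax n) mth.
  - move=> x _; rewrite lee_fin /= ge_max lerD2r ler_norm andbT.
    by rewrite addr_ge0 ?bmax_ge0.
under eq_integral do rewrite EFinD.
rewrite ge0_integralD //; first last.
- apply/measurable_EFinP; exact: measurableT_comp (measurable_bmax n) mth.
- by move=> x _; rewrite lee_fin bmax_ge0.
- exact/measurable_EFinP.
rewrite lte_add_pinfty //.
by rewrite ge0_integral_mp //; [exact: measurable_bmax|exact: bmax_ge0].
Qed.

Lemma integrable_bmax n : Q.-integrable setT (EFin \o bmax g n).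
Proof.
apply/integrableP; split; first exact/measurable_EFinP/measurable_bmax.
under eq_integral do rewrite /= ger0_norm ?bmax_ge0 //.
exact: integral_bmax_fin.
Qed.

Definition bunbounded : set T := [set x | forall m : nat, exists n, m%:R < bmax g n x].

Lemma measurable_bunbounded : measurable bunbounded.
Proof.
have -> : bunbounded = \bigcap_(m : nat) \bigcup_(n : nat)
    (bmax g n @^-1` `]m%:R, +oo[%classic).
  apply/seteqP; split=> x /=.
    by move=> H m _; have [n h] := H m; exists n => //=; rewrite in_itv /= h.
  move=> H m; have [n _] := H m I; rewrite /= in_itv /= andbT => h.
  by exists n.
apply: bigcap_measurable => // m _; apply: bigcup_measurable => n _.
by rewrite -[X in measurable X]setTI; apply: measurable_bmax.
Qed.

(** Advancing the orbit by one point changes the partial sums by the finite amount [g x], which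
    cannot affect unboundedness. The invariance is an exact equality of sets, as [erg] demands. *)
Lemma bunbounded_inv : th @^-1` bunbounded = bunbounded.
Proof.
apply/seteqP; split=> x /= H m.
  have [k hk] := exists_nat_gt (m%:R - g x).
  have [n h] := H k; exists n.+1 => /=; rewrite lt_max; apply/orP; right.
  by rewrite -ltrBlDl (lt_trans hk).
have [k hk] := exists_nat_gt (m%:R + g x).
have [[|n] h] := H k; first by move: h; rewrite /= ltNge ler0n.
exists n; move: h; rewrite /= lt_max ltNge ler0n /= => h.
by rewrite -(ltrD2l (g x)) addrC (lt_trans hk).
Qed.

(* 0 <= E (bmax (n+1) - bmax n \o th) = E max(g, - bmax n \o th), and the
   integrand tends to g where bmax is unbounded. *)
Lemma bunbounded_mean : Q bunbounded = 1%E -> (0 <= \int[Q]_x (g x)%:E)%E.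
Proof.
move=> Q1; pose f n x := bmax g n.+1 x - bmax g n (th x).
have ith n : Q.-integrable setT (fun x => (bmax g n (th x))%:E).
  apply/integrableP; split.
    apply/measurable_EFinP; exact: measurableT_comp (measurable_bmax n) mth.
  under eq_integral do rewrite /= ger0_norm ?bmax_ge0 //.
  rewrite ge0_integral_mp; [exact: integral_bmax_fin|exact: measurable_bmax|].
  exact: bmax_ge0.
have fE n : (0 <= \int[Q]_x (f n x)%:E)%E.
  rewrite /f; under eq_integral do rewrite EFinB.
  rewrite integralB //; last exact: integrable_bmax.
  rewrite ge0_integral_mp; [|exact: measurable_bmax|exact: bmax_ge0].
  rewrite sube_ge0; last first.
    apply/orP; left; rewrite ge0_fin_numE; first exact: integral_bmax_fin.
    by apply: integral_ge0 => x _; rewrite lee_fin bmax_ge0.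
  apply: ge0_le_integral => //.
  - by move=> x _; rewrite lee_fin bmax_ge0.
  - exact/measurable_EFinP/measurable_bmax.
  - exact/measurable_EFinP/measurable_bmax.
  - by move=> x _; rewrite lee_fin bmax_leS.
have fmax n x : f n x = Num.max (- bmax g n (th x)) (g x).
  by rewrite /f /= addr_maxl sub0r addrK.
have mf n : measurable_fun setT (fun x => (f n x)%:E).
  apply/measurable_EFinP/measurable_funB; first exact: (measurable_bmax n.+1).
  exact: measurableT_comp (measurable_bmax n) mth.
have mge : measurable_fun setT (fun x => (g x)%:E) by exact/measurable_EFinP.
have cv : {ae Q, forall x, setT x -> (fun n => (f n x)%:E) @ \oo --> (g x)%:E}.
  exists (~` bunbounded); split.
  - exact/measurableC/measurable_bunbounded.
  - by rewrite probability_setC ?Q1 ?subee //; exact: measurable_bunbounded.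
  move=> x /= nH Hx; apply: nH => _.
  have [k hk] := exists_nat_gt (- g x).
  have : (th @^-1` bunbounded) x by rewrite bunbounded_inv.
  move=> /(_ k) [n0 hn0].
  apply/cvg_EFin; first exact: nearW.
  apply: cvg_near_cst; exists n0 => // n /= n0n.
  rewrite /= fmax; apply/eqP; rewrite eq_maxr // lerNl ltW //.
  by rewrite (lt_le_trans hk) // ltW // (lt_le_trans hn0) // bmax_mono.
have dom : {ae Q, forall x n, setT x -> (`|(f n x)%:E| <= `|g x|%:E)%E}.
  apply: aeW => x n _; rewrite lee_fin fmax.
  have := bmax_ge0 g n (th x); move: (bmax _ _ _) => b b0.
  case: (leP (- b) (g x)) => [_|gb]; first exact: lexx.
  rewrite normrN (ger0_norm b0) ler_normr; apply/orP; right.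
  by rewrite lerNr; exact: ltW.
have [_ _ cvi] := @dominated_convergence _ _ R Q setT measurableT
  (fun n x => (f n x)%:E) (fun x => (g x)%:E) (fun x => `|g x|%:E) mf mge cv
  (integrable_norm ig) dom.
by apply: (cvge_ge _ cvi); apply: nearW => n; exact: fE.
Qed.

(** By ergodicity the invariant event [bunbounded] has probability 0 or 1, and [bunbounded_mean]
    excludes 1 when the mean is negative. *)
Lemma bsum_bounded_of_neg_mean : (\int[Q]_x (g x)%:E < 0)%E ->
  {ae Q, forall x, exists c, forall n, bsum g n x <= c}.
Proof.
move=> g0; have [Q0|/bunbounded_mean] := erg measurable_bunbounded bunbounded_inv.
  exists bunbounded; split=> //; first exact: measurable_bunbounded.
  move=> x /= nH m; apply: contrapT => nm; apply: nH; exists m%:R => n.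
  apply: le_trans (bsum_le_bmax _ _ _) _; rewrite leNgt; apply/negP => h.
  by apply: nm; exists n.
by rewrite leNgt g0.
Qed.

End Birkhoff.

(** * Almost sure convergence of ergodic averages *)

Section BirkhoffTheorem.
Context d (T : measurableType d) (R : realType) (Q : probability T R).
Variable th : T -> T.
Hypothesis mth : measurable_fun setT th.
Hypothesis Qth : forall A, measurable A -> Q (th @^-1` A) = Q A.
Hypothesis erg : forall A, measurable A -> th @^-1` A = A ->
  Q A = 0%E \/ Q A = 1%E.

Lemma bsumD (g h : T -> R) n x : bsum th (fun x => g x + h x) n x =
  bsum th g n x + bsum th h n x.
Proof. exact: big_split. Qed.

Lemma bsumN (g : T -> R) n x : bsum th (fun x => - g x) n x = - bsum th g n x.
Proof. by rewrite /bsum -sumrN. Qed.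

Lemma bsum_cst (c : R) n x : bsum th (fun=> c) n x = n%:R * c.
Proof. by rewrite /bsum sumr_const card_ord mulr_natl. Qed.

(** Subtracting [E + e] leaves a function of mean [- e < 0], whose partial sums are bounded
    above. *)
Lemma bsum_upper (g : T -> R) (e : R) : Q.-integrable setT (EFin \o g) -> 0 < e ->
  {ae Q, forall x, exists c, forall n,
     bsum th g n x <= n%:R * (fine (\int[Q]_x (g x)%:E) + e) + c}.
Proof.
move=> ig e0; set E := fine _.
have EE : (\int[Q]_x (g x)%:E)%E = E%:E.
  by rewrite fineK //; exact: integrable_fin_num ig.
have ic : Q.-integrable setT (EFin \o cst (- (E + e))).
  exact: finite_measure_integrable_cst.
have igc : Q.-integrable setT (EFin \o (fun x => g x + - (E + e))).
  exact: (integrableD measurableT ig ic).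
have neg : (\int[Q]_x (g x + - (E + e))%:E < 0)%E.
  have -> : (\int[Q]_x (g x + - (E + e))%:E =
      \int[Q]_x (g x)%:E + \int[Q]_x (- (E + e))%:E)%E.
    by rewrite -integralD //; apply: eq_integral => x _; rewrite EFinD.
  rewrite EE integral_cst // [X in (_ * X)%E]probability_setT mule1 -EFinD lte_fin.
  by rewrite opprD addrA subrr add0r oppr_lt0.
apply: filterS (bsum_bounded_of_neg_mean mth Qth erg igc neg) => x [c hc].
exists c => n; have := hc n; rewrite bsumD bsum_cst mulrN.
by rewrite lerBlDl.
Qed.

(** The upper estimate for [g] and for [- g] gives both sides. The errors run through the countable
    family [e k], so that one null set serves for all of them. *)
Theorem birkhoff (g : T -> R) : Q.-integrable setT (EFin \o g) ->
  {ae Q, forall x, (fun n => bsum th g n x / n%:R) @ \oo -->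
     fine (\int[Q]_x (g x)%:E)}.
Proof.
move=> ig; have ign : Q.-integrable setT (EFin \o (fun x => - g x)).
  exact: (integrableN ig).
set E := fine _.
have EN : fine (\int[Q]_x (- g x)%:E) = - E.
  have -> : (\int[Q]_x (- g x)%:E = (-1)%:E * \int[Q]_x (g x)%:E)%E.
    rewrite -integralZl //; apply: eq_integral => x _.
    by rewrite -EFinM mulN1r.
  rewrite -[(\int[Q]_x (g x)%:E)%E]fineK -/E; first by rewrite /= mulN1r.
  exact: integrable_fin_num ig.
pose e (k : nat) : R := k.+1%:R^-1.
have e0 k : 0 < e k by rewrite invr_gt0.
have up : {ae Q, forall x, forall k, exists c, forall n,
    bsum th g n x <= n%:R * (E + e k) + c}.
  by apply: ae_foralln => k; exact: bsum_upper.
have lo : {ae Q, forall x, forall k, exists c, forall n,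
    - bsum th g n x <= n%:R * (- E + e k) + c}.
  apply: ae_foralln => k; have := bsum_upper ign (e0 k); rewrite EN.
  by apply: filterS => x [c hc]; exists c => n; rewrite -bsumN.
apply: filterS2 up lo => x up lo.
apply/cvgrPdist_le => eps eps0.
have [k hk] : exists k, e k <= eps / 2.
  exists (Num.bound (2 / eps)); rewrite /e -[leRHS]invrK lef_pV2 ?posrE //.
    rewrite invf_div; apply: ltW; apply: lt_le_trans (archi_boundP _) _.
      by rewrite divr_ge0 // ltW.
    by rewrite ler_nat.
  by rewrite invr_gt0 divr_gt0.
have [c hc] := up k; have [c' hc'] := lo k.
pose b := `|c| + `|c'|; have b0 : 0 <= b by rewrite addr_ge0.
(* From here on [b <= n * (eps / 2)]: the additive constants cost one half of [eps] and [e k] the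
   other. The successor excludes [n = 0]. *)
exists (Num.bound (b / (eps / 2))).+1 => // n /= hn.
have n0 : 0 < n%:R :> R by rewrite ltr0n (leq_ltn_trans _ hn).
have bn : b <= n%:R * (eps / 2).
  rewrite -ler_pdivrMr ?divr_gt0 //; apply: ltW.
  apply: lt_le_trans (archi_boundP _) _; last by rewrite ler_nat ltnW.
  by rewrite divr_ge0 // divr_ge0 // ltW.
have cb : c <= b by rewrite (le_trans (ler_norm _)) // lerDl.
have cb' : c' <= b by rewrite (le_trans (ler_norm _)) // lerDr.
have H1 := hc n; have H2 := hc' n.
have nek : n%:R * e k <= n%:R * (eps / 2) by rewrite ler_pM2l.
rewrite ler_norml; apply/andP; split.
  rewrite -subr_ge0 -(pmulr_rge0 _ n0).
  rewrite (_ : _ * _ = n%:R * E + n%:R * eps - bsum th g n x); last first.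
    by field; rewrite gt_eqF.
  by nra.
rewrite -subr_ge0 -(pmulr_rge0 _ n0).
rewrite (_ : _ * _ = n%:R * eps - n%:R * E + bsum th g n x); last first.
  by field; rewrite gt_eqF.
by nra.
Qed.

End BirkhoffTheorem.

(** * Convergence and trajectories *)

Section ComplexConvergence.
Variable R : realType.
Local Notation C := R[i].
Local Notation "r %:C" := (real_complex R r).

(** Convergence is split into real coordinates, so that monotone convergence in [R] can be used and
    limits match the coordinatewise notion of measurability. *)
Definition ccvg (u : nat -> C) (l : C) : Prop :=
  ((fun n => complex.Re (u n)) @ \oo --> complex.Re l) /\
  ((fun n => complex.Im (u n)) @ \oo --> complex.Im l).

Lemma ccvg_cst (c : C) : ccvg (fun=> c) c.
Proof. by split; exact: cvg_cst. Qed.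

Lemma ccvgD u v (a b : C) : ccvg u a -> ccvg v b ->
  ccvg (fun n => u n + v n) (a + b).
Proof.
move=> [ua ua'] [vb vb']; split.
  rewrite cReD; under eq_fun do rewrite cReD; exact: cvgD.
rewrite cImD; under eq_fun do rewrite cImD; exact: cvgD.
Qed.

Lemma ccvgM u v (a b : C) : ccvg u a -> ccvg v b ->
  ccvg (fun n => u n * v n) (a * b).
Proof.
move=> [ua ua'] [vb vb']; split.
  rewrite cReM; under eq_fun do rewrite cReM.
  by apply: cvgB; exact: cvgM.
rewrite cImM; under eq_fun do rewrite cImM.
by apply: cvgD; exact: cvgM.
Qed.

Lemma ccvg_conj u (a : C) : ccvg u a -> ccvg (fun n => (u n)^*%C) a^*%C.
Proof.
have e (x : C) : complex.Re x^*%C = complex.Re x /\ complex.Im x^*%C = - complex.Im x.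
  by case: x.
move=> [ua ua']; split.
  by rewrite (e _).1; under eq_fun do rewrite (e _).1.
by rewrite (e _).2; under eq_fun do rewrite (e _).2; exact: cvgN.
Qed.

Lemma cReV (x : C) : complex.Re x^-1 =
  complex.Re x / (complex.Re x ^+ 2 + complex.Im x ^+ 2).
Proof. by case: x. Qed.
Lemma cImV (x : C) : complex.Im x^-1 =
  - (complex.Im x / (complex.Re x ^+ 2 + complex.Im x ^+ 2)).
Proof. by case: x. Qed.

Lemma ccvgV u (a : C) : a != 0 -> ccvg u a -> ccvg (fun n => (u n)^-1) a^-1.
Proof.
move=> a0 [ua ua'].
have n0 : complex.Re a ^+ 2 + complex.Im a ^+ 2 != 0.
  apply: contra a0; rewrite paddr_eq0 ?sqr_ge0 // !sqrf_eq0.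
  by move=> /andP[/eqP h1 /eqP h2]; apply/eqP/complex_eqP.
have nc : (fun n => (complex.Re (u n) ^+ 2 + complex.Im (u n) ^+ 2)^-1) @ \oo -->
    (complex.Re a ^+ 2 + complex.Im a ^+ 2)^-1.
  apply: cvgV => //; rewrite !expr2; under eq_fun do rewrite !expr2.
  by apply: cvgD; exact: cvgM.
split.
  by rewrite cReV; under eq_fun do rewrite cReV; exact: cvgM.
by rewrite cImV; under eq_fun do rewrite cImV; apply: cvgN; exact: cvgM.
Qed.

Lemma ccvg_sum (I : Type) (s : seq I) (u : I -> nat -> C) (a : I -> C) :
  (forall i, ccvg (u i) (a i)) ->
  ccvg (fun n => \sum_(i <- s) u i n) (\sum_(i <- s) a i).
Proof.
move=> h; elim: s => [|i s IH].
  rewrite big_nil (_ : (fun n => _) = fun=> 0); first exact: ccvg_cst.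
  by apply/funext => n; rewrite big_nil.
rewrite big_cons (_ : (fun n => _) = fun n => u i n + \sum_(j <- s) u j n).
  exact: ccvgD.
by apply/funext => n; rewrite big_cons.
Qed.

Lemma ccvg_prod (I : Type) (s : seq I) (u : I -> nat -> C) (a : I -> C) :
  (forall i, ccvg (u i) (a i)) ->
  ccvg (fun n => \prod_(i <- s) u i n) (\prod_(i <- s) a i).
Proof.
move=> h; elim: s => [|i s IH].
  rewrite big_nil (_ : (fun n => _) = fun=> 1); first exact: ccvg_cst.
  by apply/funext => n; rewrite big_nil.
rewrite big_cons (_ : (fun n => _) = fun n => u i n * \prod_(j <- s) u j n).
  exact: ccvgM.
by apply/funext => n; rewrite big_cons.
Qed.

Definition mcvg p q (U : nat -> 'M[C]_(p, q)) (L : 'M[C]_(p, q)) : Prop :=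
  forall i j, ccvg (fun n => U n i j) (L i j).

Lemma eq_ccvg u v (a b : C) : u =1 v -> a = b -> ccvg u a -> ccvg v b.
Proof. by move=> uv -> ; rewrite (funext uv). Qed.

Lemma mcvg_cst p q (A : 'M[C]_(p, q)) : mcvg (fun=> A) A.
Proof. by move=> i j; exact: ccvg_cst. Qed.

Lemma mcvgD p q U V (A B : 'M[C]_(p, q)) : mcvg U A -> mcvg V B ->
  mcvg (fun n => U n + V n) (A + B).
Proof.
move=> ua vb i j; apply: eq_ccvg (ccvgD (ua i j) (vb i j)) => [n|];
  by rewrite mxE.
Qed.

Lemma mcvgZ p q U (r : C) (A : 'M[C]_(p, q)) : mcvg U A ->
  mcvg (fun n => r *: U n) (r *: A).
Proof.
move=> ua i j; apply: eq_ccvg (ccvgM (ccvg_cst r) (ua i j)) => [n|];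
  by rewrite mxE.
Qed.

Lemma mcvgM p q r U V (A : 'M[C]_(p, q)) (B : 'M[C]_(q, r)) :
  mcvg U A -> mcvg V B -> mcvg (fun n => U n *m V n) (A *m B).
Proof.
move=> ua vb i j.
apply: eq_ccvg (ccvg_sum (index_enum _) (fun k => ccvgM (ua i k) (vb k j)))
  => [n|]; by rewrite mxE.
Qed.

Lemma ccvg_det p U (A : 'M[C]_p) : mcvg U A -> ccvg (fun n => \det (U n)) (\det A).
Proof.
move=> ua; rewrite /determinant; apply: ccvg_sum => s.
by apply: ccvgM; [exact: ccvg_cst|apply: ccvg_prod => i; exact: ua].
Qed.

(** Cramer's rule: the entries of the inverse are cofactors divided by a determinant with nonzero
    limit. *)
Lemma mcvg_inv p U (A : 'M[C]_p) : (forall n, U n \in unitmx) -> A \in unitmx ->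
  mcvg U A -> mcvg (fun n => invmx (U n)) (invmx A).
Proof.
move=> uU uA ua i j.
apply: (@eq_ccvg (fun n => (\det (U n))^-1 * cofactor (U n) j i) _
  ((\det A)^-1 * cofactor A j i)).
- by move=> n; rewrite /invmx uU !mxE.
- by rewrite /invmx uA !mxE.
apply: ccvgM; first by apply/ccvgV/ccvg_det => //; rewrite -unitfE -unitmxE.
rewrite /cofactor; apply: ccvgM; first exact: ccvg_cst.
apply: ccvg_det => a b.
by apply: eq_ccvg (ua (lift j a) (lift i b)) => [n|]; rewrite !mxE.
Qed.

Lemma cvg_qf p U (A : 'M[C]_p) v : mcvg U A ->
  (fun n => qf (U n) v) @ \oo --> qf A v.
Proof.
move=> ua; have [h _] := mcvgM (mcvgM (mcvg_cst (ctr v)) ua) (mcvg_cst v) 0 0.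
exact: h.
Qed.

Lemma rcvg_shift (u : nat -> R) (l : R) :
  ((fun n => u n.+1) @ \oo --> l) <-> (u @ \oo --> l).
Proof. by rewrite -(cvg_shiftS u). Qed.

Lemma rcvg_unique (u : nat -> R) (a b : R) :
  u @ \oo --> a -> u @ \oo --> b -> a = b.
Proof. by move=> ua ub; rewrite -(cvg_lim _ ua) // (cvg_lim _ ub). Qed.

Lemma rcvg_le (u v : nat -> R) (a b : R) : u @ \oo --> a -> v @ \oo --> b ->
  (forall n, u n <= v n) -> a <= b.
Proof.
move=> ua vb uv; rewrite -(cvg_lim _ ua) // -(cvg_lim _ vb) //.
apply: ler_lim; [by apply/cvg_ex; exists a|by apply/cvg_ex; exists b|].
exact: nearW.
Qed.

Lemma mcvg_unique p q U (A B : 'M[C]_(p, q)) : mcvg U A -> mcvg U B -> A = B.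
Proof.
move=> ua ub; apply/matrixP => i j.
have [h1 h2] := ua i j; have [h3 h4] := ub i j.
by apply: complex_eqP; [exact: rcvg_unique h1 h3|exact: rcvg_unique h2 h4].
Qed.

Lemma mcvg_herm p U (A : 'M[C]_p) : (forall n, Defs.hermitian (U n)) ->
  mcvg U A -> Defs.hermitian A.
Proof.
move=> hU ua; apply: (@mcvg_unique _ _ U) => // i j.
apply: eq_ccvg (ccvg_conj (ua j i)) => [n|]; last by rewrite !mxE.
by rewrite (herm_entry j i (hU n)).
Qed.

Lemma lew_cvg p U V (A B : 'M[C]_p) : mcvg U A -> mcvg V B ->
  (forall n, lew (U n) (V n)) -> lew A B.
Proof.
move=> ua vb uv v; apply: (rcvg_le (cvg_qf (v := v) ua) (cvg_qf (v := v) vb)) => n.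
exact: uv.
Qed.

Definition mlim p q (U : nat -> 'M[C]_(p, q)) : 'M[C]_(p, q) :=
  \matrix_(i, j) Complex (limn (fun n => complex.Re (U n i j)))
                         (limn (fun n => complex.Im (U n i j))).

(** For each vector the form values decrease and are nonnegative, hence converge; polarization
    transfers this to the entries. *)
Lemma mcvg_decr p (U : nat -> 'M[C]_p) : (forall n, Defs.hermitian (U n)) ->
  (forall n, psd (U n)) -> (forall n, lew (U n.+1) (U n)) -> mcvg U (mlim U).
Proof.
move=> hU pU dU.
have cq v : cvgn (fun n => qf (U n) v).
  apply: nonincreasing_is_cvgn; first by apply/nonincreasing_seqP => n; exact: dU.
  by exists 0 => _ [n _ <-]; exact: pU.
move=> i j; rewrite /ccvg mxE /=; split.
  suff : cvgn (fun n => complex.Re (U n i j)) by [].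
  under eq_fun do rewrite (Re_entryE _ _ (hU _)).
  apply: is_cvgMl; apply: is_cvgB; last exact: cq.
  by apply: is_cvgB; exact: cq.
suff : cvgn (fun n => complex.Im (U n i j)) by [].
under eq_fun do rewrite (Im_entryE _ _ (hU _)).
apply: is_cvgMl; apply: is_cvgB; last exact: cq.
by apply: is_cvgD; exact: cq.
Qed.

Lemma cvg_logdet p U (A : 'M[C]_p) : hpd A -> mcvg U A ->
  (fun n => logdet (U n)) @ \oo --> logdet A.
Proof.
move=> /hpd_det[a0 _] /ccvg_det[h _].
by apply: (cvg_comp _ _ h); exact: continuous_ln.
Qed.

Lemma mcvg_shift p q U (A : 'M[C]_(p, q)) : mcvg U A ->
  mcvg (fun n => U n.+1) A.
Proof.
move=> ua i j; have [h1 h2] := ua i j; split.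
  exact: (rcvg_shift (fun n => complex.Re (U n i j)) _).2 h1.
exact: (rcvg_shift (fun n => complex.Im (U n i j)) _).2 h2.
Qed.

End ComplexConvergence.

(** * The pullback solution of the recursion *)

Section Trajectories.
Variables (R : realType) (N K : nat) (rho : R).
Hypothesis rho0 : 0 < rho.
Local Notation C := R[i].
Local Notation "r %:C" := (real_complex R r).
Implicit Types (F G : int -> 'M[C]_(N, K)).

Lemma mcvg_AF (F : 'M[C]_(N, K)) U (A : 'M[C]_K) : mcvg U A ->
  mcvg (fun n => AF rho F (U n)) (AF rho F A).
Proof.
move=> ua; apply: mcvgD; first exact: mcvg_cst.
by apply/mcvgZ/mcvgM; [apply: mcvgM => //|]; exact: mcvg_cst.
Qed.

Lemma mcvg_Wstep (F G : 'M[C]_(N, K)) U (A : 'M[C]_K) : (forall n, hpsd (U n)) ->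
  hpsd A -> mcvg U A -> mcvg (fun n => Wstep rho F G (U n)) (Wstep rho F G A).
Proof.
move=> hU hA ua; apply: mcvg_inv.
- by move=> n; exact/hpd_unit/(SG1_hpd rho0 F G (hU n)).
- exact/hpd_unit/(SG1_hpd rho0 F G hA).
apply: mcvgD; first exact: mcvg_cst.
apply/mcvgZ/mcvgM; last exact: mcvg_cst.
apply: mcvgM; first exact: mcvg_cst.
apply: mcvg_inv; last exact: mcvg_AF.
- by move=> n; exact/hpd_unit/(AF_hpd rho0 F (hU n)).
- exact/hpd_unit/(AF_hpd rho0 F hA).
Qed.

(* Solution at time n started from the identity j steps earlier. *)
Fixpoint Xfrom F G (n : int) (j : nat) : 'M[C]_K :=
  if j is j'.+1 then Wstep rho (F n) (G n) (Xfrom F G (n - 1) j') else 1%:M.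

Lemma Xfrom_hpd F G n j : hpd (Xfrom F G n j).
Proof.
elim: j n => [|j IH] n; first exact: hpd1.
exact/(Wstep_hpd rho0 (F n) (G n))/hpd_hpsd/IH.
Qed.

Lemma Xfrom_hpsd F G n j : hpsd (Xfrom F G n j).
Proof. exact/hpd_hpsd/Xfrom_hpd. Qed.

Lemma Xfrom_le1 F G n j : lew (Xfrom F G n j) 1%:M.
Proof.
case: j => [|j]; first exact: lew_refl.
exact: (Wstep_le1 rho0 (F n) (G n) (Xfrom_hpsd F G (n - 1) j)).
Qed.

(** Starting one step earlier replaces the initial identity by an output of the step, which is
    smaller; monotonicity propagates this to time [n]. *)
Lemma Xfrom_decr F G n j : lew (Xfrom F G n j.+1) (Xfrom F G n j).
Proof.
elim: j n => [|j IH] n; first exact: Xfrom_le1.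
exact: (Wstep_mono rho0 (F n) (G n) (Xfrom_hpsd F G (n - 1) j.+1)
  (Xfrom_hpsd F G (n - 1) j) (IH (n - 1))).
Qed.

Definition Wlim F G (n : int) : 'M[C]_K := mlim (Xfrom F G n).

Lemma Xfrom_mcvg F G n : mcvg (Xfrom F G n) (Wlim F G n).
Proof.
apply: mcvg_decr => j; last exact: Xfrom_decr.
  by case: (Xfrom_hpd F G n j).
exact/hpd_psd/Xfrom_hpd.
Qed.

Lemma Wlim_hpsd F G n : hpsd (Wlim F G n).
Proof.
apply/hpsdP; split.
  by apply: (mcvg_herm _ (Xfrom_mcvg F G n)) => j; case: (Xfrom_hpd F G n j).
move=> v; rewrite -(qf0 v).
apply: (lew_cvg (mcvg_cst 0) (Xfrom_mcvg F G n)) => j u.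
by rewrite qf0; exact: (hpd_psd (Xfrom_hpd F G n j)).
Qed.

Lemma Wlim_rec F G n : Wlim F G n = Wstep rho (F n) (G n) (Wlim F G (n - 1)).
Proof.
apply: (mcvg_unique (mcvg_shift (Xfrom_mcvg F G n))).
exact: (mcvg_Wstep (F n) (G n) (Xfrom_hpsd F G (n - 1)) (Wlim_hpsd F G (n - 1))
  (Xfrom_mcvg F G (n - 1))).
Qed.

(** A limit of positive definite matrices is a priori only semidefinite; one application of the
    recursion restores definiteness. *)
Lemma Wlim_hpd F G n : hpd (Wlim F G n).
Proof. rewrite Wlim_rec; exact/Wstep_hpd/Wlim_hpsd. Qed.

Lemma Wlim_le1 F G n : lew (Wlim F G n) 1%:M.
Proof. rewrite Wlim_rec; exact/Wstep_le1/Wlim_hpsd. Qed.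

Lemma Xfrom_shift F G n j :
  Xfrom (shift1 F) (shift1 G) n j = Xfrom F G (n + 1) j.
Proof.
elim: j n => [//|j IH] n /=; rewrite IH /shift1.
by have -> : n - 1 + 1 = n + 1 - 1 by rewrite addrAC.
Qed.

Lemma Wlim_shift F G n : Wlim (shift1 F) (shift1 G) n = Wlim F G (n + 1).
Proof.
by rewrite /Wlim; congr mlim; apply/funext => j; exact: Xfrom_shift.
Qed.

(** [Xrec] at index [n] is the value at time [n - 1], reached in [n] steps from the identity at time
    [-1]. *)
Lemma Xrec_Xfrom F G n : Xrec rho F G 1%:M n = Xfrom F G (n%:Z - 1) n.
Proof.
elim: n => [//|n IH]; rewrite [LHS]/= [RHS]/= IH.
by have -> : Posz n.+1 - 1 = n%:Z by rewrite -addn1 PoszD addrK.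
Qed.

(** * Forgetting of the initial condition *)

Definition gain_at G (n : int) : R := gain rho (G n).

Definition kprod G (n : int) (j : nat) : R :=
  \prod_(k < j) kap rho (G (n - k%:Z)).

Lemma kprod_ge0 G n j : 0 <= kprod G n j.
Proof. by apply: prodr_ge0 => k _; exact: kap_ge0. Qed.

Lemma kprodS G n j : kprod G n j.+1 = kap rho (G n) * kprod G (n - 1) j.
Proof.
rewrite /kprod big_ord_recl subr0; congr (_ * _); apply: eq_bigr => k _.
have -> : nat_of_ord (lift ord0 k) = k.+1 by [].
by congr (kap _ (G _)); rewrite -addn1 PoszD opprD addrA addrAC.
Qed.

(** At time [n - j] both solutions are outputs of the same step, hence comparable up to the gain
    there; the [j] later steps contribute the product of their rates. *)
Lemma backward_contract F G (W W' : int -> 'M[C]_K) :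
  (forall n, hpsd (W n)) -> (forall n, hpsd (W' n)) ->
  (forall n, W n = Wstep rho (F n) (G n) (W (n - 1))) ->
  (forall n, W' n = Wstep rho (F n) (G n) (W' (n - 1))) ->
  forall j n, lew (W n)
    ((1 + kprod G n j * gain_at G (n - j%:Z))%:C *: W' n).
Proof.
move=> hW hW' eW eW'; elim=> [|j IH] n.
  rewrite /kprod big_ord0 mul1r subr0 (eW n) (eW' n).
  apply: lew_trans (Wstep_le1 rho0 _ _ (hW (n - 1))) _.
  exact: (Wstep_ge rho0 (F n) (G n) (hW' (n - 1))).
rewrite kprodS (eW n) (eW' n) -mulrA.
have -> : n - Posz j.+1 = n - 1 - j%:Z.
  by rewrite -addn1 PoszD opprD addrA addrAC.
apply: (Wstep_contract rho0 (F n) (G n) (hW' (n - 1)) (hW (n - 1)) _ (IH (n - 1))).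
by rewrite mulr_ge0 ?kprod_ge0 // gain_ge0.
Qed.

(* The contraction factors of the steps with gain at most A are bounded away
   from 1. *)
Lemma prod_kap_cvg0 (g : nat -> R) (A : R) : (forall k, 0 <= g k) ->
  (forall m, exists2 k, (m <= k)%N & g k <= A) ->
  forall e, 0 < e -> exists j, forall i, (j <= i)%N ->
    \prod_(k < i) (g k / (1 + g k)) <= e.
Proof.
move=> g0 freq.
pose p i := \prod_(k < i) (g k / (1 + g k)).
have k0 k : 0 <= g k / (1 + g k) by rewrite divr_ge0 // addr_ge0.
have k1 k : g k / (1 + g k) <= 1.
  by rewrite ler_pdivrMr ?mul1r ?lerDr // ltr_pwDl.
have p0 i : 0 <= p i by apply: prodr_ge0.
have pS i : p i.+1 = p i * (g i / (1 + g i)) by rewrite /p big_ord_recr.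
have pm i j : (i <= j)%N -> p j <= p i.
  move=> /subnK <-; elim: (j - i)%N => [//|k IH]; rewrite addSn pS.
  by apply: le_trans IH; rewrite ler_piMr.
have A0 : 0 <= A by have [k _ h] := freq 0%N; exact: le_trans h.
pose q := A / (1 + A).
have q0 : 0 <= q by rewrite divr_ge0 // addr_ge0.
have q1 : q < 1 by rewrite ltr_pdivrMr ?mul1r ?ltrDr // ltr_pwDl.
have H n : exists j, p j <= q ^+ n.
  elim: n => [|n [j hj]]; first by exists 0%N; rewrite /p big_ord0 expr0.
  have [k jk gk] := freq j; exists k.+1; rewrite pS exprSr.
  apply: ler_pM => //; first exact: le_trans (pm _ _ jk) hj.
  have a1 : 0 < 1 + g k by rewrite ltr_pwDl.
  have a2 : 0 < 1 + A by rewrite ltr_pwDl.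
  rewrite /q ler_pdivrMr // mulrAC ler_pdivlMr //.
  by rewrite !mulrDr !mulr1 [A * _]mulrC lerD2r.
move=> e e0; have qc : (fun n => q ^+ n) @ \oo --> (0 : R).
  by apply: cvg_expr; rewrite ger0_norm.
have [n _ hn] := cvgr_lt _ qc e e0.
have [j hj] := H n; exists j => i ji; apply: le_trans (pm _ _ ji) _.
by apply: le_trans hj _; apply: ltW; exact: (hn n (leqnn n)).
Qed.

(** The comparison reaching back [k] steps needs a small product and, at the same [k], a bounded
    gain. The product stays small for all large [k], so a late visit to gains below [A] satisfies
    both. *)
Lemma solutions_unique F G (W W' : int -> 'M[C]_K) (A : R) (n : int) :
  (forall n, hpsd (W n)) -> (forall n, hpsd (W' n)) ->
  (forall n, W n = Wstep rho (F n) (G n) (W (n - 1))) ->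
  (forall n, W' n = Wstep rho (F n) (G n) (W' (n - 1))) ->
  (forall m : nat, exists2 k, (m <= k)%N & gain_at G (n - k%:Z) <= A) ->
  W n = W' n.
Proof.
move=> hW hW' eW eW' freq.
suff half V V' : (forall n, hpsd (V n)) -> (forall n, hpsd (V' n)) ->
    (forall n, V n = Wstep rho (F n) (G n) (V (n - 1))) ->
    (forall n, V' n = Wstep rho (F n) (G n) (V' (n - 1))) -> lew (V n) (V' n).
  have /hpsdP[h _] := hW n; have /hpsdP[h' _] := hW' n.
  apply: (qf_inj h h') => v; apply: le_anti; apply/andP; split.
    exact: (half W W' hW hW' eW eW' v).
  exact: (half W' W hW' hW eW' eW v).
move=> hV hV' eV eV' v.
have A0 : 0 <= A by have [k _ h] := freq 0%N; apply: le_trans h; exact: gain_ge0.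
have q0 : 0 <= qf (V' n) v by have /hpsdP[_] := hV' n; exact.
apply/ler_addgt0Pr => e e0.
(* Chosen so that [A * qf (V' n) v <= B]; the added units keep [B] positive. *)
pose B := A * (qf (V' n) v + 1) + 1.
have B0 : 0 < B by rewrite ltr_pwDr // mulr_ge0 // addr_ge0.
have [j hj] := prod_kap_cvg0 (fun k => gain_ge0 rho0 (G (n - k%:Z))) freq
  (divr_gt0 e0 B0).
have [k jk gk] := freq j; have pk := hj k jk.
have := backward_contract hV hV' eV eV' k n v.
rewrite qfZ mulrDl mul1r => h; apply: le_trans h _; rewrite lerD2l.
apply: (@le_trans _ _ (e / B * A * qf (V' n) v)).
  apply: ler_wpM2r => //; apply: ler_pM => //; first exact: kprod_ge0.
  exact: gain_ge0.
rewrite -mulrA mulrAC ler_pdivrMr // ler_wpM2l ?(ltW e0) //.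
by rewrite /B mulrDr mulr1 -addrA lerDl addr_ge0.
Qed.

(** The initial values may be singular, hence incomparable. The step at time 0 makes them
    comparable, so the estimate begins at index 1 and the rates at time 1. *)
Lemma forward_contract F G (X Y : nat -> 'M[C]_K) :
  hpsd (X 0%N) -> hpsd (Y 0%N) ->
  (forall n, X n.+1 = Wstep rho (F n%:Z) (G n%:Z) (X n)) ->
  (forall n, Y n.+1 = Wstep rho (F n%:Z) (G n%:Z) (Y n)) ->
  forall n, lew (X n.+1) ((1 + gain_at G 0 *
    \prod_(k < n) kap rho (G k.+1%:Z))%:C *: Y n.+1).
Proof.
move=> hX hY eX eY.
have pX n : hpsd (X n) by elim: n => [//|n IH]; rewrite eX; exact: (Wstep_hpsd rho0 _ _ IH).
have pY n : hpsd (Y n) by elim: n => [//|n IH]; rewrite eY; exact: (Wstep_hpsd rho0 _ _ IH).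
elim=> [|n IH].
  rewrite big_ord0 mulr1 (eX 0%N) (eY 0%N).
  apply: lew_trans (Wstep_le1 rho0 _ _ hX) _.
  exact: (Wstep_ge rho0 (F 0) (G 0) hY).
rewrite big_ord_recr /= (eX n.+1) (eY n.+1) mulrA mulrC.
apply: (Wstep_contract rho0 _ _ (pY n.+1) (pX n.+1) _ IH).
rewrite mulr_ge0 ?gain_ge0 //; apply: prodr_ge0 => k _; exact: kap_ge0.
Qed.

Definition step_info (F G : 'M[C]_(N, K)) (X : 'M[C]_K) : R :=
  ldF rho F X - logdet (Wstep rho F G X).

Lemma step_info_bounds (F G : 'M[C]_(N, K)) (X : 'M[C]_K) : hpsd X -> lew X 1%:M ->
  0 <= step_info F G X <= rho * frob2 F + rho * frob2 G.
Proof.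
move=> hX X1; have /andP[a b] := ldF_bounds rho0 F hX X1.
have /andP[c e] := logdet_Wstep_bounds rho0 F G hX.
by rewrite /step_info addr_ge0 //= lerD.
Qed.

(** A factor [1 + e] between positive definite matrices of size [n] moves [logdet] by at most
    [n * ln (1 + e)], and the factors tend to 1. *)
Lemma forward_info_diff F G (X Y : nat -> 'M[C]_K) (A : R) :
  hpsd (X 0%N) -> hpsd (Y 0%N) ->
  (forall n, X n.+1 = Wstep rho (F n%:Z) (G n%:Z) (X n)) ->
  (forall n, Y n.+1 = Wstep rho (F n%:Z) (G n%:Z) (Y n)) ->
  (forall m : nat, exists2 k, (m <= k)%N & gain_at G k.+1%:Z <= A) ->
  (fun n : nat => step_info (F n%:Z) (G n%:Z) (X n)
                  - step_info (F n%:Z) (G n%:Z) (Y n)) @ \oo --> 0.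
Proof.
move=> hX hY eX eY freq.
have pX n : hpsd (X n) by elim: n => [//|n IH]; rewrite eX; exact: (Wstep_hpsd rho0 _ _ IH).
have pY n : hpsd (Y n) by elim: n => [//|n IH]; rewrite eY; exact: (Wstep_hpsd rho0 _ _ IH).
have dX n : hpd (X n.+1) by rewrite eX; exact: (Wstep_hpd rho0 _ _ (pX n)).
have dY n : hpd (Y n.+1) by rewrite eY; exact: (Wstep_hpd rho0 _ _ (pY n)).
pose e n := gain_at G 0 * \prod_(k < n) kap rho (G k.+1%:Z).
have e0 n : 0 <= e n.
  rewrite mulr_ge0 ?gain_ge0 //; apply: prodr_ge0 => k _; exact: kap_ge0.
have XY n : lew (X n.+1) ((1 + e n)%:C *: Y n.+1).
  exact: (forward_contract hX hY eX eY).
have YX n : lew (Y n.+1) ((1 + e n)%:C *: X n.+1).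
  exact: (forward_contract hY hX eY eX).
have ec : e @ \oo --> 0.
  apply/cvgrPdist_le => eps eps0.
  have g0 := gain_ge0 rho0 (G 0).
  have g1 : 0 < gain_at G 0 + 1 by rewrite ltr_pwDr.
  have [j hj] := prod_kap_cvg0 (fun k => gain_ge0 rho0 (G k.+1%:Z)) freq
    (divr_gt0 eps0 g1).
  exists j => // i /= ji; rewrite sub0r normrN ger0_norm //.
  apply: le_trans (ler_wpM2l g0 (hj i ji)) _.
  rewrite mulrCA ler_piMr ?(ltW eps0) // ler_pdivrMr // mul1r.
  by rewrite lerDl.
pose l n := ln (1 + e n).
have lc : l @ \oo --> 0.
  have : (fun n => 1 + e n) @ \oo --> (1 : R) + 0.
    by apply: cvgD; [exact: cvg_cst|exact: ec].
  rewrite addr0 /l -(ln1 R) => e1.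
  exact: (cvg_comp (fun n => 1 + e n) (@ln R) e1 (continuous_ln ltr01)).
(* The first term accounts for [ldF] at index [n.+1], of size [N]; the second for the [logdet] of
   the next state, of size [K]. *)
pose b n := N%:R * l n + K%:R * l n.+1.
have bc : b @ \oo --> 0.
  have : b @ \oo --> N%:R * (0 : R) + K%:R * 0.
    apply: cvgD; apply: cvgM; [exact: cvg_cst|exact: lc|exact: cvg_cst|].
    exact: (rcvg_shift l 0).2 lc.
  by rewrite !mulr0 addr0.
apply: (rcvg_shift (fun n : nat => step_info (F n%:Z) (G n%:Z) (X n)
  - step_info (F n%:Z) (G n%:Z) (Y n)) 0).1.
have bNc : (fun n => - b n) @ \oo --> 0 by rewrite -oppr0; exact: cvgN.
apply: (squeeze_cvgr _ bNc bc); apply: nearW => n.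
have h1 := ldF_ratio rho0 (F n.+1%:Z) (pX n.+1) (pY n.+1) (e0 n) (YX n).
have h2 := ldF_ratio rho0 (F n.+1%:Z) (pY n.+1) (pX n.+1) (e0 n) (XY n).
have h3 := logdet_ratio (dX n.+1) (dY n.+1) (e0 n.+1) (YX n.+1).
have h4 := logdet_ratio (dY n.+1) (dX n.+1) (e0 n.+1) (XY n.+1).
rewrite /step_info -(eX n.+1) -(eY n.+1).
move: h1 h2 h3 h4; rewrite -/(l n) -/(l n.+1) /b.
move: (ldF _ _ _) (ldF _ _ _) (logdet _) (logdet _) => x1 x2 x3 x4.
move: (N%:R * l n) (K%:R * l n.+1) => y1 y2 h1 h2 h3 h4.
by apply/andP; split; lra.
Qed.

End Trajectories.

(** * Measurability and path spaces *)

Section ComplexMeasurability.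
Context d (T : measurableType d) (R : realType).
Local Notation C := R[i].

Definition cmeas (f : T -> C) : Prop :=
  measurable_fun setT (fun x => complex.Re (f x)) /\
  measurable_fun setT (fun x => complex.Im (f x)).

Lemma cmeas_cst (c : C) : cmeas (fun=> c).
Proof. by split; exact: measurable_cst. Qed.

Lemma cmeasD f g : cmeas f -> cmeas g -> cmeas (fun x => f x + g x).
Proof.
move=> [f1 f2] [g1 g2]; split.
  by under eq_fun do rewrite cReD; exact: measurable_funD.
by under eq_fun do rewrite cImD; exact: measurable_funD.
Qed.

Lemma cmeasM f g : cmeas f -> cmeas g -> cmeas (fun x => f x * g x).
Proof.
move=> [f1 f2] [g1 g2]; split.
  by under eq_fun do rewrite cReM; apply: measurable_funB; exact: measurable_funM.
by under eq_fun do rewrite cImM; apply: measurable_funD; exact: measurable_funM.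
Qed.

Lemma cmeas_conj f : cmeas f -> cmeas (fun x => (f x)^*%C).
Proof.
have e (x : C) : complex.Re x^*%C = complex.Re x /\ complex.Im x^*%C = - complex.Im x.
  by case: x.
move=> [f1 f2]; split.
  by under eq_fun do rewrite (e _).1.
by under eq_fun do rewrite (e _).2; exact: measurableT_comp f2.
Qed.

Lemma cmeasV f : cmeas f -> cmeas (fun x => (f x)^-1).
Proof.
move=> [f1 f2].
have n1 : measurable_fun setT
    (fun x => (complex.Re (f x) ^+ 2 + complex.Im (f x) ^+ 2)^-1).
  (* On nonnegative reals, 0 included, inversion is the power of exponent [-1], a measurable
     function. *)
  under eq_fun do rewrite -powR_inv1 ?addr_ge0 ?sqr_ge0 //.
  apply: (measurableT_comp (measurable_powR _)).
  by apply: measurable_funD; exact: measurable_funX.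
split.
  by under eq_fun do rewrite cReV; exact: measurable_funM.
under eq_fun do rewrite cImV.
by apply: measurableT_comp => //; exact: measurable_funM.
Qed.

Lemma cmeas_sum (I : Type) (s : seq I) (f : I -> T -> C) :
  (forall i, cmeas (f i)) -> cmeas (fun x => \sum_(i <- s) f i x).
Proof.
move=> h; elim: s => [|i s IH].
  by under eq_fun do rewrite big_nil; exact: cmeas_cst.
by under eq_fun do rewrite big_cons; exact: cmeasD.
Qed.

Lemma cmeas_prod (I : Type) (s : seq I) (f : I -> T -> C) :
  (forall i, cmeas (f i)) -> cmeas (fun x => \prod_(i <- s) f i x).
Proof.
move=> h; elim: s => [|i s IH].
  by under eq_fun do rewrite big_nil; exact: cmeas_cst.
by under eq_fun do rewrite big_cons; exact: cmeasM.
Qed.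

Definition mmeas p q (U : T -> 'M[C]_(p, q)) : Prop :=
  forall i j, cmeas (fun x => U x i j).

Lemma mmeas_cst p q (A : 'M[C]_(p, q)) : mmeas (fun=> A).
Proof. by move=> i j; exact: cmeas_cst. Qed.

Lemma mmeasD p q (U V : T -> 'M[C]_(p, q)) : mmeas U -> mmeas V ->
  mmeas (fun x => U x + V x).
Proof. by move=> u v i j; under eq_fun do rewrite mxE; exact: cmeasD. Qed.

Lemma mmeasZ p q (r : C) (U : T -> 'M[C]_(p, q)) : mmeas U ->
  mmeas (fun x => r *: U x).
Proof.
by move=> u i j; under eq_fun do rewrite mxE; apply: cmeasM => //; exact: cmeas_cst.
Qed.

Lemma mmeasM p q r (U : T -> 'M[C]_(p, q)) (V : T -> 'M[C]_(q, r)) :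
  mmeas U -> mmeas V -> mmeas (fun x => U x *m V x).
Proof.
move=> u v i j; under eq_fun do rewrite mxE.
by apply: cmeas_sum => k; exact: cmeasM.
Qed.

Lemma mmeas_ctr p q (U : T -> 'M[C]_(p, q)) : mmeas U -> mmeas (fun x => ctr (U x)).
Proof.
by move=> u i j; under eq_fun do rewrite !mxE; exact: cmeas_conj.
Qed.

Lemma cmeas_det p (U : T -> 'M[C]_p) : mmeas U -> cmeas (fun x => \det (U x)).
Proof.
move=> u; rewrite /determinant; apply: cmeas_sum => s.
by apply: cmeasM; [exact: cmeas_cst|apply: cmeas_prod => i; exact: u].
Qed.

Lemma mmeas_inv p (U : T -> 'M[C]_p) : (forall x, U x \in unitmx) ->
  mmeas U -> mmeas (fun x => invmx (U x)).
Proof.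
move=> uU u i j.
have -> : (fun x => invmx (U x) i j) =
    (fun x => (\det (U x))^-1 * cofactor (U x) j i).
  by apply/funext => x; rewrite /invmx uU !mxE.
apply: cmeasM; first exact/cmeasV/cmeas_det.
rewrite /cofactor; apply: cmeasM; first exact: cmeas_cst.
by apply: cmeas_det => a b; under eq_fun do rewrite !mxE; exact: u.
Qed.

Lemma measurable_logdet p (U : T -> 'M[C]_p) : mmeas U ->
  measurable_fun setT (fun x => logdet (U x)).
Proof.
by move=> /cmeas_det[u _]; exact: measurableT_comp (@measurable_ln R) u.
Qed.

Lemma mmeas_lim p q (U : nat -> T -> 'M[C]_(p, q)) (L : T -> 'M[C]_(p, q)) :
  (forall n, mmeas (U n)) -> (forall x, mcvg (U ^~ x) (L x)) -> mmeas L.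
Proof.
move=> u cv i j; split.
  apply: (@measurable_fun_cvg _ _ _ _ (fun n x => complex.Re (U n x i j))).
    by move=> n; have [] := u n i j.
  by move=> x _; have [] := cv x i j.
apply: (@measurable_fun_cvg _ _ _ _ (fun n x => complex.Im (U n x i j))).
  by move=> n; have [] := u n i j.
by move=> x _; have [] := cv x i j.
Qed.

Lemma measurable_frob2 p q (U : T -> 'M[C]_(p, q)) : mmeas U ->
  measurable_fun setT (fun x => frob2 (U x)).
Proof.
move=> u; apply: measurable_sum => i; apply: measurable_sum => j.
have [h1 h2] := u i j.
by apply: measurable_funD; exact: measurable_funX.
Qed.

Section Recursion.
Variables (N K : nat) (rho : R).
Hypothesis rho0 : 0 < rho.

Lemma mmeas_AF (F : T -> 'M[C]_(N, K)) (U : T -> 'M[C]_K) : mmeas F -> mmeas U ->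
  mmeas (fun x => AF rho (F x) (U x)).
Proof.
move=> f u; apply: mmeasD; first exact: mmeas_cst.
by apply/mmeasZ/mmeasM; [exact: mmeasM|exact: mmeas_ctr].
Qed.

Lemma mmeas_Wstep (F G : T -> 'M[C]_(N, K)) (U : T -> 'M[C]_K) :
  (forall x, hpsd (U x)) -> mmeas F -> mmeas G -> mmeas U ->
  mmeas (fun x => Wstep rho (F x) (G x) (U x)).
Proof.
move=> hU f g u; apply: mmeas_inv.
  by move=> x; exact: hpd_unit (SG1_hpd rho0 (F x) (G x) (hU x)).
apply: mmeasD; first exact: mmeas_cst.
apply/mmeasZ/mmeasM => //; apply: mmeasM; first exact: mmeas_ctr.
apply: mmeas_inv; last exact: mmeas_AF.
by move=> x; exact: hpd_unit (AF_hpd rho0 (F x) (hU x)).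
Qed.

Lemma measurable_step_info (F G : T -> 'M[C]_(N, K)) (U : T -> 'M[C]_K) :
  (forall x, hpsd (U x)) -> mmeas F -> mmeas G -> mmeas U ->
  measurable_fun setT (fun x => step_info rho (F x) (G x) (U x)).
Proof.
move=> hU f g u; apply: measurable_funB; apply: measurable_logdet.
  exact: (mmeas_AF f u).
exact: (mmeas_Wstep hU f g u).
Qed.

Variables (F G : int -> T -> 'M[C]_(N, K)).
Hypotheses (mF : forall k, mmeas (F k)) (mG : forall k, mmeas (G k)).

Lemma mmeas_Xfrom n j : mmeas (fun x => Xfrom rho (F ^~ x) (G ^~ x) n j).
Proof.
elim: j n => [|j IH] n; first exact: mmeas_cst.
exact: (mmeas_Wstep (fun x => Xfrom_hpsd rho0 (F ^~ x) (G ^~ x) (n - 1) j)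
  (mF n) (mG n) (IH (n - 1))).
Qed.

Lemma mmeas_Wlim n : mmeas (fun x => Wlim rho (F ^~ x) (G ^~ x) n).
Proof.
apply: (mmeas_lim (mmeas_Xfrom n)) => x.
exact: (Xfrom_mcvg rho0 (F ^~ x) (G ^~ x) n).
Qed.

End Recursion.
End ComplexMeasurability.

(** * The space of real paths and the shift *)

Section PathSpace.
Variables (R : realType) (I : Type).

(** Measurable sets of this type are by conversion the [path_measurable] ones, so [stationary] and
    [ergodic] apply to them directly. *)
Definition paths := g_sigma_algebraType (@cylinders R I).

Lemma measurable_coord (k : int) (i : I) :
  measurable_fun setT (fun x : paths => x k i).
Proof.
move=> _ B mB; rewrite setTI; apply: sub_sigma_algebra.
by exists k, i, B.
Qed.

Lemma measurable_to_paths d (T : measurableType d) (f : T -> paths) :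
  (forall k i, measurable_fun setT (fun x => f x k i)) -> measurable_fun setT f.
Proof.
move=> h; apply: (@measurability _ _ T (g_sigma_algebraType (@cylinders R I))
  setT f (@cylinders R I)) => //.
move=> _ [_ [k [i [B [mB ->]]]] <-]; rewrite setTI -comp_preimage.
by rewrite -[X in measurable X]setTI; exact: h.
Qed.

Lemma measurable_pshift : measurable_fun setT (@pshift R I : paths -> paths).
Proof. by apply: measurable_to_paths => k i; exact: measurable_coord. Qed.

End PathSpace.

Section Processes.
Context (R : realType) d (Omega : measurableType d) (P : probability Omega R).

Lemma measurable_path (T I : Type) (c : T -> I -> R) (Z : int -> Omega -> T) :
  rprocess c Z -> measurable_fun setT (Defs.path c Z : Omega -> paths R I).
Proof. by move=> h; apply: measurable_to_paths => k i; exact: h. Qed.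

Lemma factor_stationary (T I T' J : Type) (c : T -> I -> R)
    (Z : int -> Omega -> T) (c' : T' -> J -> R) (Z' : int -> Omega -> T')
    (phi : paths R I -> paths R J) :
  measurable_fun setT phi -> (forall x, phi (pshift x) = pshift (phi x)) ->
  (forall w, Defs.path c' Z' w = phi (Defs.path c Z w)) ->
  stationary P c Z -> stationary P c' Z'.
Proof.
move=> mphi ephi eZ [rZ sZ].
have mpre (A : set (paths R J)) : measurable A -> measurable (phi @^-1` A).
  by move=> mA; rewrite -[X in measurable X]setTI; exact: mphi.
split=> [k j|A mA].
  have -> : (fun w => c' (Z' k w) j) = (fun w => phi (Defs.path c Z w) k j).
    by apply/funext => w; rewrite -eZ.
  exact: (measurableT_comp (measurable_coord k j)
    (measurableT_comp mphi (measurable_path rZ))).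
have eP : Defs.path c' Z' = phi \o Defs.path c Z.
  by apply/funext => w; exact: eZ.
have eS : (fun w => pshift (Defs.path c' Z' w)) =
    phi \o (fun w => pshift (Defs.path c Z w)).
  by apply/funext => w /=; rewrite ephi eZ.
rewrite eS eP; exact: (sZ _ (mpre _ mA)).
Qed.

(** Exact equivariance makes the preimage under [phi] of a shift-invariant set again
    shift-invariant. *)
Lemma factor_ergodic (T I T' J : Type) (c : T -> I -> R)
    (Z : int -> Omega -> T) (c' : T' -> J -> R) (Z' : int -> Omega -> T')
    (phi : paths R I -> paths R J) :
  measurable_fun setT phi -> (forall x, phi (pshift x) = pshift (phi x)) ->
  (forall w, Defs.path c' Z' w = phi (Defs.path c Z w)) ->
  ergodic P c Z -> ergodic P c' Z'.
Proof.
move=> mphi ephi eZ eg A mA iA.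
have -> : Defs.path c' Z' = phi \o Defs.path c Z by apply/funext => w; exact: eZ.
have mA' : measurable (phi @^-1` (A : set (paths R J))).
  by rewrite -[X in measurable X]setTI; exact: mphi.
have e x : A (phi (pshift x)) = A (phi x) by rewrite ephi -[in RHS]iA.
apply: (eg _ mA'); apply/funext => x; exact: e.
Qed.

Lemma ae_pushforward d' (T : measurableType d') (f : Omega -> T)
    (mf : measurable_fun setT f) (Q : probability T R) (A : T -> Prop) :
  (forall B, measurable B -> Q B = P (f @^-1` B)) ->
  {ae Q, forall x, A x} -> {ae P, forall w, A (f w)}.
Proof.
move=> QP [B [mB B0 AB]]; exists (f @^-1` B); split.
- by rewrite -[X in measurable X]setTI; exact: mf.
- by rewrite -QP.
- by move=> w /= nA; apply: AB.
Qed.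

Variables (T I : Type) (c : T -> I -> R) (Z : int -> Omega -> T).
Hypothesis sZ : stationary P c Z.

Lemma path_stationary_iter (A : set (paths R I)) n : measurable A ->
  P ((fun w => iter n (@pshift R I) (Defs.path c Z w)) @^-1` A) = P (Defs.path c Z @^-1` A).
Proof.
elim: n A => [//|n IH] A mA.
have mA' : measurable ((@pshift R I : paths R I -> paths R I) @^-1` A).
  by rewrite -[X in measurable X]setTI; exact: measurable_pshift.
rewrite -(sZ.2 A mA); exact: (IH _ mA').
Qed.

Lemma integral_path_iter (f : paths R I -> R) n : measurable_fun setT f ->
  (forall x, 0 <= f x) ->
  (\int[P]_w (f (iter n (@pshift R I) (Defs.path c Z w)))%:E =
   \int[P]_w (f (Defs.path c Z w))%:E)%E.
Proof.
move=> mf f0.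
have mp := measurable_path sZ.1.
have mit : measurable_fun setT
    (fun w => iter n (@pshift R I) (Defs.path c Z w) : paths R I).
  elim: n => [//|n IH] /=.
  exact: measurableT_comp (@measurable_pshift R I) IH.
have mef : measurable_fun setT (EFin \o f) by exact/measurable_EFinP.
have ef0 : {in setT, forall y, (0 <= (EFin \o f) y)%E}.
  by move=> x _; rewrite lee_fin.
have h1 := ge0_integral_pushforward mit P measurableT mef ef0.
have h2 := ge0_integral_pushforward mp P measurableT mef ef0.
rewrite !preimage_setT in h1 h2; rewrite -[LHS]h1 -[RHS]h2.
apply: eq_measure_integral => A mA _.
exact: path_stationary_iter.
Qed.

Hypothesis eZ : ergodic P c Z.

(** The law of the process is a shift-invariant ergodic measure on paths; [birkhoff] holds for it,
    and its null set pulls back to [Omega]. *)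
Theorem birkhoff_path (f : paths R I -> R) : measurable_fun setT f ->
  P.-integrable setT (fun w => (f (Defs.path c Z w))%:E) ->
  {ae P, forall w,
    (fun n => (\sum_(k < n) f (iter k (@pshift R I) (Defs.path c Z w))) / n%:R) @ \oo
    --> fine (\int[P]_w (f (Defs.path c Z w))%:E)}.
Proof.
move=> mf fi; have mp := measurable_path sZ.1.
pose X : {mfun Omega >-> paths R I} := HB.pack (Defs.path c Z : Omega -> paths R I)
  (isMeasurableFun.Build _ _ _ _ _ mp).
pose Q : probability (paths R I) R := distribution P X.
have Qth A : measurable A ->
    Q ((@pshift R I : paths R I -> paths R I) @^-1` A) = Q A.
  by move=> mA; exact: sZ.2.
have Qe A : measurable A -> (@pshift R I : paths R I -> paths R I) @^-1` A = A ->
    Q A = 0%E \/ Q A = 1%E.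
  by move=> mA iA; exact: eZ.
have mef : measurable_fun setT (EFin \o f) by exact/measurable_EFinP.
have iQ : Q.-integrable setT (EFin \o f).
  by apply: (integrable_pushforward mp mef) => //; rewrite preimage_setT.
have -> : (\int[P]_w (f (Defs.path c Z w))%:E = \int[Q]_x (f x)%:E)%E.
  have := integral_pushforward mp mef _ measurableT.
  by rewrite preimage_setT => ->.
apply: (ae_pushforward mp _ (birkhoff (@measurable_pshift R I) Qth Qe iQ)).
by [].
Qed.

End Processes.

(** * Recurrence and integrability *)

Section Misc.
Variable R : realType.
Local Notation C := R[i].

(** Each of the [q] columns is the image of a unit basis vector, so its norm is at most the spectral
    norm. *)
Lemma frob2_le_specnorm p q (M : 'M[C]_(p, q)) :
  frob2 M <= q%:R * specnorm M ^+ 2.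
Proof.
pose S := [set Num.sqrt (complex.Re ((ctr v *m ctr M *m M *m v) 0 0)) |
  v in [set v : 'cV[C]_q | (ctr v *m v) 0 0 = 1]].
have qfE v : complex.Re ((ctr v *m ctr M *m M *m v) 0 0) = qf (ctr M *m M) v.
  by rewrite /qf !mulmxA.
have q1 (v : 'cV[C]_q) : (ctr v *m v) 0 0 = 1 -> qf 1%:M v = 1 :> R.
  by rewrite /qf mulmx1 => ->.
have /hpsdP[hM pM] := ctrM_hpsd M.
(* [sup] dominates the members of the set only once the set is known to be bounded; the trace
   provides a bound. *)
have ubS : has_ubound S.
  exists (Num.sqrt (frob2 M)) => _ [v v1 <-]; rewrite ler_wsqrtr // qfE.
  by have := lew_tr hM pM v; rewrite qfZ (q1 v v1) mulr1 mxtrace_mulC frob2E.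
have col j : \sum_i (complex.Re (M i j) ^+ 2 + complex.Im (M i j) ^+ 2) <=
    specnorm M ^+ 2.
  set c := \sum_i _; have c0 : 0 <= c.
    by apply: sumr_ge0 => i _; rewrite addr_ge0 // sqr_ge0.
  have qc : qf (ctr M *m M) (delta_mx j 0) = c.
    rewrite qf_delta mxE cRe_sum; apply: eq_bigr => i _.
    by rewrite !mxE cRe_conjM.
  have : Num.sqrt c <= specnorm M.
    apply: ub_le_sup => //; exists (delta_mx j 0); last by rewrite qfE qc.
    rewrite /= mxE (bigD1 j) //= big1 ?addr0.
      by rewrite !mxE !eqxx conjc_nat mulr1.
    by move=> i ij; rewrite !mxE (negbTE ij) mulr0.
  move=> h; rewrite -{1}(sqr_sqrtr c0) ler_sqr ?nnegrE ?sqrtr_ge0 //.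
  exact: le_trans (sqrtr_ge0 _) h.
have -> : q%:R * specnorm M ^+ 2 = \sum_(j < q) specnorm M ^+ 2.
  by rewrite sumr_const card_ord mulr_natl.
by rewrite /frob2 exchange_big /=; apply: ler_sum => j _; exact: col.
Qed.

Lemma cesaro0 (u : nat -> R) (l : R) : u @ \oo --> l ->
  (fun n => (\sum_(k < n) u k) / n%:R) @ \oo --> l.
Proof.
move=> /cesaro h; apply: (rcvg_shift (fun n => (\sum_(k < n) u k) / n%:R) l).1.
rewrite (_ : (fun n => _) = arithmetic_mean u) //.
by apply/funext => n; rewrite /arithmetic_mean /series /= big_mkord mulrC.
Qed.

Context d (T : measurableType d) (P : probability T R).

(** The integral of a nonnegative function is a supremum over simple functions below it, hence
    monotone without measurability. It is applied to [specnorm], a supremum over an uncountable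
    set. *)
Lemma ge0_le_integral_upper (f g : T -> \bar R) : (forall x, 0 <= f x)%E ->
  (forall x, f x <= g x)%E -> (\int[P]_x f x <= \int[P]_x g x)%E.
Proof.
move=> f0 fg; have g0 x : (0 <= g x)%E by exact: le_trans (f0 x) (fg x).
rewrite !ge0_integralTE //; apply: le_ereal_sup => _ [h hf <-].
by exists h => // x; exact: le_trans (hf x) (fg x).
Qed.

Lemma integrable_frob2 p q (M : T -> 'M[C]_(p, q)) :
  measurable_fun setT (fun w => frob2 (M w)) -> (0 < q)%N ->
  (\int[P]_w ((specnorm (M w)) ^+ 2)%:E < +oo)%E ->
  P.-integrable setT (fun w => (frob2 (M w))%:E).
Proof.
move=> mM q0 fin; have q0' : 0 < q%:R :> R by rewrite ltr0n.
have ik : P.-integrable setT (fun w => (q%:R^-1 * frob2 (M w))%:E).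
  apply/integrableP; split.
    by apply/measurable_EFinP; exact: measurable_funM.
  apply: le_lt_trans fin; apply: ge0_le_integral_upper => // w.
  rewrite lee_fin ger0_norm; last by rewrite mulr_ge0 ?frob2_ge0 // invr_ge0 ltW.
  by rewrite ler_pdivrMl //; exact: frob2_le_specnorm.
have -> : (fun w => (frob2 (M w))%:E) =
    (fun w => q%:R%:E * (q%:R^-1 * frob2 (M w))%:E)%E.
  by apply/funext => w; rewrite -EFinM mulrA divff ?mul1r // gt_eqF.
exact: integrableZl.
Qed.

Lemma ae_forall_int (A : int -> T -> Prop) :
  (forall n, {ae P, forall w, A n w}) -> {ae P, forall w n, A n w}.
Proof.
move=> h; have h1 := ae_foralln (fun n : nat => h (Posz n)).
have h2 := ae_foralln (fun n : nat => h (Negz n)).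
by apply: filterS2 h1 h2 => w p q [n|n].
Qed.

(* P(X_k > A for all k >= m) <= P(X_0 > A) -> 0 as A grows. *)
Lemma recurrence (X : nat -> T -> R) : (forall k, measurable_fun setT (X k)) ->
  (forall k a, P (X k @^-1` `]a, +oo[%classic) = P (X 0%N @^-1` `]a, +oo[%classic)) ->
  {ae P, forall w, exists a, forall m, exists2 k, (m <= k)%N & X k w <= a}.
Proof.
move=> mX eX; have mpre k a : measurable (X k @^-1` `]a, +oo[%classic).
  by rewrite -[X in measurable X]setTI; exact: mX.
pose D (a m : nat) := \bigcap_(k in [set k | (m <= k)%N]) (X k @^-1` `]a%:R, +oo[%classic).
have mD a m : measurable (D a m) by exact: bigcap_measurableType.
pose E (a : nat) := \bigcup_m D a m.
have mE a : measurable (E a) by exact: bigcup_measurable.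
have ED a : (P (E a) <= P (X 0%N @^-1` `]a%:R, +oo[%classic))%E.
  have cv : P \o D a @ \oo --> P (E a).
    apply: nondecreasing_cvg_mu => //; first exact: mE.
    move=> m n mn; apply/subsetPset => w H k /= nk; apply: H => /=.
    exact: leq_trans mn nk.
  apply: (cvge_le _ cv); apply: nearW => m /=.
  rewrite -(eX m a%:R); apply: le_measure; rewrite ?inE //.
  by move=> w; apply => /=.
have F0 : (fun a : nat => P (X 0%N @^-1` `]a%:R, +oo[%classic)) @ \oo --> 0%E.
  have <- : P (\bigcap_(a : nat) (X 0%N @^-1` `]a%:R, +oo[%classic)) = 0%E.
    rewrite (_ : \bigcap_a _ = set0) ?measure0 //.
    apply/seteqP; split=> // w H; have [k hk] := exists_nat_gt (X 0%N w).
    by have := H k I; rewrite /= in_itv /= andbT ltNge (ltW hk).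
  apply: nonincreasing_cvg_mu => //.
  - by apply: le_lt_trans (probability_le1 P (mpre _ _)) _; rewrite ltry.
  - exact: bigcap_measurableType.
  - move=> m n mn; apply/subsetPset => w /=; rewrite !in_itv /= !andbT.
    by apply: le_lt_trans; rewrite ler_nat.
exists (\bigcap_a E a); split.
- exact: bigcap_measurableType.
- apply/eqP; rewrite eq_le measure_ge0 andbT.
  apply: (cvge_ge _ F0); apply: nearW => a.
  apply: le_trans (ED a); apply: le_measure; rewrite ?inE //.
    exact: bigcap_measurableType.
  by move=> w; apply.
move=> w /= nH a _; apply: contrapT => nE; apply: nH; exists a%:R => m.
apply: contrapT => nk; apply: nE; exists m => // k /= mk.
rewrite in_itv /= andbT ltNge; apply/negP => Xa; apply: nk.
by exists k.
Qed.

End Misc.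

(** * The theorem *)

Section Channel.
Variables (R : realType) (N K : nat) (rho : R).
Hypotheses (K0 : (0 < K)%N) (rho0 : 0 < rho).
Local Notation C := R[i].
Local Notation I := (bool * ('I_N * 'I_K * bool))%type.
Local Notation T := (paths R I).
Local Notation th := (@pshift R I).

(** Rebuilds the channel matrices from a coordinate path, [true] giving [F] and [false] giving [G]
    as in [pair_coord], so that solutions become functions on path space. *)
Definition chan (b : bool) (x : T) (k : int) : 'M[C]_(N, K) :=
  \matrix_(i, j) Complex (x k (b, (i, j, true))) (x k (b, (i, j, false))).

Lemma mmeas_chan b k : mmeas (fun x : T => chan b x k).
Proof.
move=> i j; split.
  have -> : (fun x : T => complex.Re (chan b x k i j)) =
      (fun x => x k (b, (i, j, true))) by apply/funext => x; rewrite mxE.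
  exact: measurable_coord.
have -> : (fun x : T => complex.Im (chan b x k i j)) =
    (fun x => x k (b, (i, j, false))) by apply/funext => x; rewrite mxE.
exact: measurable_coord.
Qed.

Lemma chan_pshift b x : chan b (th x) = shift1 (chan b x).
Proof. by apply/funext => k; apply/matrixP => i j; rewrite !mxE. Qed.

Lemma chan_iter b n x k : chan b (iter n th x) k = chan b x (k + n%:Z).
Proof.
elim: n k => [|n IH] k; first by rewrite addr0.
rewrite iterS chan_pshift /shift1 IH.
by congr (chan b x _); rewrite -addn1 PoszD [n%:Z + 1]addrC addrA.
Qed.

Lemma Xfrom_chan_iter n x k j :
  Xfrom rho (chan true (iter n th x)) (chan false (iter n th x)) k j =
  Xfrom rho (chan true x) (chan false x) (k + n%:Z) j.
Proof.
elim: j k => [//|j IH] k /=; rewrite !chan_iter IH.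
by have -> : k - 1 + n%:Z = k + n%:Z - 1 by rewrite addrAC.
Qed.

Lemma Wlim_chan_iter n x k :
  Wlim rho (chan true (iter n th x)) (chan false (iter n th x)) k =
  Wlim rho (chan true x) (chan false x) (k + n%:Z).
Proof. by congr mlim; apply/funext => j; exact: Xfrom_chan_iter. Qed.

(** The term of time 0 for the solution equal to the identity at time [-1 - j]. Evaluated on the
    path shifted [j] times, it is the [j]-th term of the log-determinant formula. *)
Definition info_from (j : nat) (x : T) : R :=
  step_info rho (chan true x 0) (chan false x 0)
    (Xfrom rho (chan true x) (chan false x) (- 1) j).

Definition info_lim (x : T) : R :=
  step_info rho (chan true x 0) (chan false x 0)
    (Wlim rho (chan true x) (chan false x) (- 1)).

Definition info_bound (x : T) : R :=
  rho * frob2 (chan true x 0) + rho * frob2 (chan false x 0).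

Lemma measurable_info_from j : measurable_fun setT (info_from j).
Proof.
apply: (measurable_step_info rho0 (F := fun x => chan true x 0)
  (G := fun x => chan false x 0)).
- by move=> x; exact: Xfrom_hpsd.
- exact: mmeas_chan.
- exact: mmeas_chan.
exact: (mmeas_Xfrom rho0 (F := fun k x => chan true x k)
  (G := fun k x => chan false x k) (mmeas_chan true) (mmeas_chan false)).
Qed.

Lemma measurable_info_lim : measurable_fun setT info_lim.
Proof.
apply: (measurable_step_info rho0 (F := fun x => chan true x 0)
  (G := fun x => chan false x 0)).
- by move=> x; exact: Wlim_hpsd.
- exact: mmeas_chan.
- exact: mmeas_chan.
exact: (mmeas_Wlim rho0 (F := fun k x => chan true x k)
  (G := fun k x => chan false x k) (mmeas_chan true) (mmeas_chan false)).
Qed.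

Lemma info_from_bounds j x : 0 <= info_from j x <= info_bound x.
Proof.
apply: (step_info_bounds rho0); first exact: Xfrom_hpsd.
exact: Xfrom_le1.
Qed.

Lemma info_lim_bounds x : 0 <= info_lim x <= info_bound x.
Proof.
apply: (step_info_bounds rho0); first exact: Wlim_hpsd.
exact: Wlim_le1.
Qed.

Lemma info_from_cvg x : (fun j => info_from j x) @ \oo --> info_lim x.
Proof.
have cX := Xfrom_mcvg rho0 (chan true x) (chan false x) (- 1).
have hX := Xfrom_hpsd rho0 (chan true x) (chan false x) (- 1).
have hW := Wlim_hpsd rho0 (chan true x) (chan false x) (- 1).
apply: cvgB; apply: cvg_logdet.
- exact: (AF_hpd rho0 (chan true x 0) hW).
- exact: (mcvg_AF rho (chan true x 0) cX).
- exact: (Wstep_hpd rho0 (chan true x 0) (chan false x 0) hW).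
- exact: (mcvg_Wstep rho0 (chan true x 0) (chan false x 0) hX hW cX).
Qed.

Definition Wpath (x : T) : paths R ('I_K * 'I_K * bool) :=
  fun k i => cmx_coord (Wlim rho (chan true x) (chan false x) k) i.

Lemma measurable_Wpath : measurable_fun setT Wpath.
Proof.
apply: measurable_to_paths => k [[i j] b].
have [h1 h2] := mmeas_Wlim rho0 (F := fun k x => chan true x k)
  (G := fun k x => chan false x k) (mmeas_chan true) (mmeas_chan false) k i j.
by case: b.
Qed.

Lemma Wpath_pshift x : Wpath (th x) = pshift (Wpath x).
Proof.
apply/funext => k; apply/funext => i.
by rewrite /Wpath /pshift !chan_pshift Wlim_shift.
Qed.

(** * Transfer to the given channel process *)

Context d (Omega : measurableType d) (P : probability Omega R).
Variables F G : int -> Omega -> 'M[C]_(N, K).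
Let Z n w := (F n w, G n w).
Let c := @pair_coord R N K.
Hypotheses (sZ : stationary P c Z) (eZ : ergodic P c Z).
Hypotheses (F2 : (\int[P]_w ((specnorm (F 0 w)) ^+ 2)%:E < +oo)%E)
           (G2 : (\int[P]_w ((specnorm (G 0 w)) ^+ 2)%:E < +oo)%E).
Let pth := Defs.path c Z : Omega -> T.

Lemma chanT w : chan true (pth w) = F ^~ w.
Proof.
apply/funext => k; apply/matrixP => i j; rewrite mxE /pth /Defs.path /c.
by rewrite /pair_coord /cmx_coord /=; case: (F k w i j).
Qed.

Lemma chanF w : chan false (pth w) = G ^~ w.
Proof.
apply/funext => k; apply/matrixP => i j; rewrite mxE /pth /Defs.path /c.
by rewrite /pair_coord /cmx_coord /=; case: (G k w i j).
Qed.

Let W (n : int) (w : Omega) : 'M[C]_K := Wlim rho (F ^~ w) (G ^~ w) n.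

Lemma W_path w : Defs.path (@cmx_coord R K K) W w = Wpath (pth w).
Proof. by rewrite /Wpath chanT chanF. Qed.

Lemma W_stationary : stationary P (@cmx_coord R K K) W.
Proof. exact: (factor_stationary measurable_Wpath Wpath_pshift W_path sZ). Qed.

Lemma W_ergodic : ergodic P (@cmx_coord R K K) W.
Proof. exact: (factor_ergodic measurable_Wpath Wpath_pshift W_path eZ). Qed.

Let mpth : measurable_fun setT pth.
Proof. exact: measurable_path sZ.1. Qed.

Lemma mmeas_path p q (U : T -> 'M[C]_(p, q)) : mmeas U ->
  mmeas (fun w => U (pth w)).
Proof.
by move=> u i j; have [h1 h2] := u i j; split;
  [exact: measurableT_comp h1 mpth|exact: measurableT_comp h2 mpth].
Qed.

Lemma mmeas_F k : mmeas (F k).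
Proof.
have -> : F k = fun w => chan true (pth w) k by apply/funext => w; rewrite chanT.
exact: mmeas_path (mmeas_chan true k).
Qed.

Lemma mmeas_G k : mmeas (G k).
Proof.
have -> : G k = fun w => chan false (pth w) k.
  by apply/funext => w; rewrite chanF.
exact: mmeas_path (mmeas_chan false k).
Qed.

Lemma measurable_gain k : measurable_fun setT (fun w => gain rho (G k w)).
Proof.
by apply: measurable_funM => //; exact: measurable_frob2 (mmeas_G k).
Qed.

(** Stationarity concerns a single shift; induction upwards on the nonnegative times and downwards
    on the negative ones reaches every [k]. *)
Lemma gain_law (k : int) (a : R) :
  P ((fun w => gain rho (G k w)) @^-1` `]a, +oo[%classic) =
  P ((fun w => gain rho (G 0 w)) @^-1` `]a, +oo[%classic).
Proof.
pose B k := (fun x : T => gain rho (chan false x k)) @^-1` `]a, +oo[%classic.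
have mB j : measurable (B j).
  rewrite -[X in measurable X]setTI.
  have m : measurable_fun setT (fun x : T => gain rho (chan false x j)).
    by apply: measurable_funM => //; exact: measurable_frob2 (mmeas_chan false j).
  exact: m.
have eB j : (fun w => gain rho (G j w)) @^-1` `]a, +oo[%classic = pth @^-1` (B j).
  by apply/funext => w; rewrite /B /preimage /= chanF.
have step j : P (pth @^-1` (B (j + 1))) = P (pth @^-1` (B j)).
  by rewrite -(sZ.2 _ (mB j)); congr (P _).
rewrite !eB; case: k => n; elim: n => [|n IH].
- by [].
- by have -> : Posz n.+1 = n%:Z + 1; [rewrite -addn1 PoszD|rewrite step].
- by rewrite -(step (Negz 0)).
- rewrite -(step (Negz n.+1)) -IH.
  have -> : Negz n.+1 + 1 = Negz n; last by [].
  by rewrite !NegzE -[n.+2]addn1 PoszD opprD addrNK.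
Qed.

Lemma forward_recurrence : {ae P, forall w, exists a, forall m,
  exists2 k, (m <= k)%N & gain_at rho (G ^~ w) k.+1%:Z <= a}.
Proof.
apply: (@recurrence _ _ _ _ (fun k w => gain rho (G k.+1%:Z w))).
  by move=> k; exact: measurable_gain.
by move=> k a; rewrite !gain_law.
Qed.

Lemma backward_recurrence (n : int) : {ae P, forall w, exists a, forall m,
  exists2 k, (m <= k)%N & gain_at rho (G ^~ w) (n - k%:Z) <= a}.
Proof.
apply: (@recurrence _ _ _ _ (fun k w => gain rho (G (n - k%:Z) w))).
  by move=> k; exact: measurable_gain.
by move=> k a; rewrite (gain_law (n - k%:Z)) (gain_law (n - 0%:Z)).
Qed.

(** The exceptional sets of all times merge into one null set, outside which the pathwise uniqueness
    applies. *)
Lemma W_unique (W' : int -> Omega -> 'M[C]_K) :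
  (forall n, {ae P, forall w, hpd (W' n w)}) ->
  (forall n : int, {ae P, forall w,
     W' n w = Wstep rho (F n w) (G n w) (W' (n - 1) w)}) ->
  forall n, {ae P, forall w, W' n w = W n w}.
Proof.
move=> /ae_forall_int hW' /ae_forall_int eW' n.
apply: filterS3 hW' eW' (backward_recurrence n) => w h e [a fr].
apply: (solutions_unique (W := W' ^~ w) (W' := W ^~ w) rho0 _ _ _ _ fr).
- by move=> k; apply: hpd_hpsd; exact: h.
- by move=> k; exact: Wlim_hpsd.
- exact: e.
- by move=> k; exact: Wlim_rec.
Qed.

(** * Integrability, expectations and limits *)

Lemma integrable_frobF : P.-integrable setT (fun w => (rho * frob2 (F 0 w))%:E).
Proof.
have h := integrable_frob2 (measurable_frob2 (mmeas_F 0)) K0 F2.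
exact: (integrableZl measurableT rho h).
Qed.

Lemma integrable_frobG : P.-integrable setT (fun w => (rho * frob2 (G 0 w))%:E).
Proof.
have h := integrable_frob2 (measurable_frob2 (mmeas_G 0)) K0 G2.
exact: (integrableZl measurableT rho h).
Qed.

Lemma integrable_bound : P.-integrable setT (fun w => (info_bound (pth w))%:E).
Proof.
have -> : (fun w => (info_bound (pth w))%:E) =
    (fun w => (rho * frob2 (F 0 w))%:E + (rho * frob2 (G 0 w))%:E)%E.
  by apply/funext => w; rewrite /info_bound chanT chanF EFinD.
exact: (integrableD measurableT integrable_frobF integrable_frobG).
Qed.

Lemma integrable_dominated (f : Omega -> R) (g : Omega -> R) :
  measurable_fun setT f -> (forall w, `|f w| <= g w) ->
  P.-integrable setT (fun w => (g w)%:E) -> P.-integrable setT (fun w => (f w)%:E).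
Proof.
move=> mf fg ig; apply: le_integrable ig => //; first exact/measurable_EFinP.
move=> w _; rewrite lee_fin; apply: le_trans (fg w) _; exact: ler_norm.
Qed.

Let mean : R := fine (\int[P]_w (info_lim (pth w))%:E).

Lemma integrable_info_lim : P.-integrable setT (fun w => (info_lim (pth w))%:E).
Proof.
apply: (integrable_dominated _ _ integrable_bound).
  exact: measurableT_comp measurable_info_lim mpth.
by move=> w; have /andP[h1 h2] := info_lim_bounds (pth w); rewrite ger0_norm.
Qed.

Lemma integrable_info_from j :
  P.-integrable setT (fun w => (info_from j (pth w))%:E).
Proof.
apply: (integrable_dominated _ _ integrable_bound).
  exact: measurableT_comp (measurable_info_from j) mpth.
by move=> w; have /andP[h1 h2] := info_from_bounds j (pth w); rewrite ger0_norm.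
Qed.

Lemma mean_info_from_cvg :
  (fun j => fine (\int[P]_w (info_from j (pth w))%:E)) @ \oo --> mean.
Proof.
have mf j : measurable_fun setT (fun w => (info_from j (pth w))%:E).
  exact: measurable_int (integrable_info_from j).
have ml : measurable_fun setT (fun w => (info_lim (pth w))%:E).
  exact: measurable_int integrable_info_lim.
have cv : {ae P, forall w, setT w ->
    (fun j => (info_from j (pth w))%:E) @ \oo --> (info_lim (pth w))%:E}.
  apply: aeW => w _; apply/cvg_EFin; first exact: nearW.
  exact: info_from_cvg.
have dom : {ae P, forall w j, setT w ->
    (`|(info_from j (pth w))%:E| <= (info_bound (pth w))%:E)%E}.
  apply: aeW => w j _; rewrite lee_fin.
  by have /andP[h1 h2] := info_from_bounds j (pth w); rewrite ger0_norm.
have [_ _ h] := dominated_convergence measurableT mf ml cv integrable_bound dom.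
apply: fine_cvg; rewrite fineK //; exact: integrable_fin_num integrable_info_lim.
Qed.

(** The shift moves time 0 to [l] and the starting time [-1 - l] to [-1], the common starting time
    of the terms of [logdet_Hmat]. *)
Lemma info_from_path l w : info_from l (iter l th (pth w)) =
  ldF rho (F l%:Z w) (Xrec rho (F ^~ w) (G ^~ w) 1%:M l)
  - logdet (Xrec rho (F ^~ w) (G ^~ w) 1%:M l.+1).
Proof.
rewrite /info_from Xfrom_chan_iter !chan_iter !add0r chanT chanF /step_info.
rewrite [Xrec _ _ _ _ l.+1]/= Xrec_Xfrom.
by have -> : - 1 + l%:Z = l%:Z - 1 by rewrite addrC.
Qed.

Lemma info_lim_path l w : info_lim (iter l th (pth w)) =
  step_info rho (F l%:Z w) (G l%:Z w) (W (l%:Z - 1) w).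
Proof.
rewrite /info_lim Wlim_chan_iter !chan_iter !add0r chanT chanF.
by have -> : - 1 + l%:Z = l%:Z - 1 by rewrite addrC.
Qed.

Lemma expected_logdet L :
  Rintegral P setT (fun w => logdet (1%:M + (rho%:C)%C *:
    (Hmat (F ^~ w) (G ^~ w) 0 L *m ctr (Hmat (F ^~ w) (G ^~ w) 0 L)))) =
  \sum_(l < L) fine (\int[P]_w (info_from l (pth w))%:E).
Proof.
rewrite /Rintegral.
have -> : (\int[P]_w (logdet (1%:M + (rho%:C)%C *:
      (Hmat (F ^~ w) (G ^~ w) 0 L *m ctr (Hmat (F ^~ w) (G ^~ w) 0 L))))%:E =
    \sum_(l < L) \int[P]_w (info_from l (pth w))%:E)%E.
  (* Each term is a fixed function of a shifted path. Nonnegativity allows the exchange of sum and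
     integral, after which stationarity removes the shift. *)
  transitivity (\int[P]_w (\sum_(l < L) (info_from l (iter l th (pth w)))%:E))%E.
    apply: eq_integral => w _; rewrite (logdet_Hmat rho0) sumEFin.
    apply: (f_equal EFin); apply: eq_bigr => l _.
    exact: esym (info_from_path l w).
  have mi n : measurable_fun setT (fun w => iter n th (pth w) : T).
    elim: n => [//|n IH] /=.
    exact: measurableT_comp (@measurable_pshift R I) IH.
  pose f (l : 'I_L) w := (info_from l (iter l th (pth w)))%:E.
  have mI l : measurable_fun setT (f l).
    apply/measurable_EFinP.
    exact: measurableT_comp (measurable_info_from l) (mi l).
  have I0 l w : setT w -> (0 <= f l w)%E.
    move=> _; rewrite /f lee_fin.
    by case/andP: (info_from_bounds l (iter l th (pth w))).
  rewrite (ge0_integral_sum P measurableT mI I0).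
  apply: eq_bigr => l _.
  apply: (integral_path_iter sZ l (measurable_info_from l)) => x.
  by case/andP: (info_from_bounds l x).
have fE l : (\int[P]_w (info_from l (pth w))%:E =
    (fine (\int[P]_w (info_from l (pth w))%:E))%:E)%E.
  by rewrite fineK //; exact: integrable_fin_num (integrable_info_from l).
by rewrite (eq_bigr _ (fun (l : 'I_L) _ => fE l)) sumEFin.
Qed.

Lemma mutual_infoE : mutual_info P F G rho = N%:R^-1 * mean.
Proof.
apply: cvg_lim => //.
have h := cesaro0 mean_info_from_cvg.
have : (fun L : nat => N%:R^-1 *
    ((\sum_(l < L) fine (\int[P]_w (info_from l (pth w))%:E)) / L%:R)) @ \oo -->
    N%:R^-1 * mean.
  by apply: cvgM => //; exact: cvg_cst.
rewrite (_ : (fun L => _ * _) = (fun L : nat => ((L * N)%:R)^-1 *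
     Rintegral P setT (fun w => logdet (1%:M + (rho%:C)%C *:
         (Hmat (F ^~ w) (G ^~ w) 0 L *m ctr (Hmat (F ^~ w) (G ^~ w) 0 L)))))) //.
by apply/funext => L; rewrite expected_logdet natrM invfM mulrA mulrC mulrA.
Qed.

(** Each term has its own integrable bound, one from [F] and one from [G], so the integral of the
    difference splits into finite parts. *)
Lemma mean_split : (mean%:E =
  \int[P]_w (ldF rho (F 0 w) (W (-1) w))%:E - \int[P]_w (logdet (W 0 w))%:E)%E.
Proof.
have eW w : W 0 w = Wstep rho (F 0 w) (G 0 w) (W (-1) w).
  rewrite /W (Wlim_rec rho0).
  by have -> : (0 - 1 : int) = -1 by rewrite add0r.
have hW w : hpsd (W (-1) w) by exact: Wlim_hpsd.
have mW n : mmeas (W n) := mmeas_Wlim rho0 mmeas_F mmeas_G n.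
have i1 : P.-integrable setT (fun w => (ldF rho (F 0 w) (W (-1) w))%:E).
  apply: (integrable_dominated _ _ integrable_frobF).
    apply: measurable_logdet; exact: (mmeas_AF rho (mmeas_F 0) (mW (-1))).
  move=> w; have /andP[h1 h2] := ldF_bounds rho0 (F 0 w) (hW w) (Wlim_le1 rho0 _ _ _).
  by rewrite ger0_norm.
have i2 : P.-integrable setT (fun w => (logdet (W 0 w))%:E).
  apply: (integrable_dominated _ _ integrable_frobG).
    exact: measurable_logdet (mW 0).
  move=> w; rewrite eW.
  have /andP[h1 h2] := logdet_Wstep_bounds rho0 (F 0 w) (G 0 w) (hW w).
  by rewrite -normrN ger0_norm.
rewrite -integralB // /mean fineK; last exact: integrable_fin_num integrable_info_lim.
apply: eq_integral => w _; rewrite -EFinB eW.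
by have := info_lim_path 0 w; rewrite /= add0r => ->.
Qed.

Lemma info_rate_cvg (X0 : 'M[C]_K) : hpsd X0 ->
  {ae P, forall w, (fun n : nat => (n * N)%:R^-1 * \sum_(l < n)
     (ldF rho (F l%:Z w) (Xrec rho (F ^~ w) (G ^~ w) X0 l)
      - logdet (Xrec rho (F ^~ w) (G ^~ w) X0 l.+1))) @ \oo
    --> mutual_info P F G rho}.
Proof.
move=> hX; rewrite mutual_infoE.
have bk := birkhoff_path sZ eZ measurable_info_lim integrable_info_lim.
apply: filterS2 bk forward_recurrence => w bk [a fr].
pose X := Xrec rho (F ^~ w) (G ^~ w) X0.
(* The offset matches [Xrec], whose index [n] is the state at time [n - 1]. *)
pose Y (n : nat) := W (n%:Z - 1) w.
have hY : hpsd (Y 0%N) by exact: Wlim_hpsd.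
have eX n : X n.+1 = Wstep rho (F n%:Z w) (G n%:Z w) (X n) by [].
have eY n : Y n.+1 = Wstep rho (F n%:Z w) (G n%:Z w) (Y n).
  rewrite /Y; have -> : Posz n.+1 - 1 = n%:Z by rewrite -addn1 PoszD addrK.
  exact: (Wlim_rec rho0 (F ^~ w) (G ^~ w) n%:Z).
have df := cesaro0 (forward_info_diff rho0 (F := F ^~ w) (G := G ^~ w) hX hY eX eY fr).
have : (fun n => N%:R^-1 * ((\sum_(k < n) info_lim (iter k th (pth w))) / n%:R +
    (\sum_(k < n) (step_info rho (F k%:Z w) (G k%:Z w) (X k)
      - step_info rho (F k%:Z w) (G k%:Z w) (Y k))) / n%:R)) @ \oo -->
    N%:R^-1 * (mean + 0).
  by apply: cvgM; [exact: cvg_cst|exact: cvgD bk df].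
rewrite addr0.
set u := (fun n => _); set v := (fun n => _).
suff -> : u = v by [].
apply/funext => n; rewrite /u /v natrM invfM -mulrDl -big_split /=.
have -> : \sum_(k < n) (info_lim (iter k th (pth w)) +
      (step_info rho (F k%:Z w) (G k%:Z w) (X k) -
       step_info rho (F k%:Z w) (G k%:Z w) (Y k))) =
    \sum_(k < n) step_info rho (F k%:Z w) (G k%:Z w) (X k).
  by apply: eq_bigr => k _; rewrite info_lim_path addrC subrK.
by rewrite mulrCA mulrC [N%:R^-1 * _]mulrC.
Qed.

End Channel.

Theorem theorem1 (R : realType) (d : measure_display)
  (Omega : measurableType d) (P : probability Omega R)
  (N K : nat) (F G : int -> Omega -> 'M[R[i]]_(N, K)) (rho : R) :
  (0 < N)%N -> (0 < K)%N ->
  (* the channel process (F_n, G_n) is stationary and ergodic *)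
  stationary P (@pair_coord R N K) (fun n w => (F n w, G n w)) ->
  ergodic P (@pair_coord R N K) (fun n w => (F n w, G n w)) ->
  (\int[P]_w ((specnorm (F 0 w)) ^+ 2)%:E < +oo)%E ->
  (\int[P]_w ((specnorm (G 0 w)) ^+ 2)%:E < +oo)%E ->
  0 < rho ->
  (* (a) and (b) *)
  (exists W : int -> Omega -> 'M[R[i]]_K,
     [/\ (stationary P (@cmx_coord R K K) W /\ forall n w, hpd (W n w)),
         (forall n : int, {ae P, forall w,
             W n w = Wstep rho (F n w) (G n w) (W (n - 1) w)}),
         (forall W' : int -> Omega -> 'M[R[i]]_K,
             stationary P (@cmx_coord R K K) W' ->
             (forall n, {ae P, forall w, hpd (W' n w)}) ->
             (forall n : int, {ae P, forall w,
                 W' n w = Wstep rho (F n w) (G n w) (W' (n - 1) w)}) ->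
             forall n, {ae P, forall w, W' n w = W n w}),
         ergodic P (@cmx_coord R K K) W
       & ((mutual_info P F G rho)%:E =
            (N%:R^-1)%:E *
            (\int[P]_w (ldF rho (F 0 w) (W (-1) w))%:E
             - \int[P]_w (logdet (W 0 w))%:E))%E])
  /\
  (* (c) *)
  (forall Xm1 : 'M[R[i]]_K, hpsd Xm1 ->
     {ae P, forall w,
       (fun n : nat => (n * N)%:R^-1 *
          \sum_(l < n)
             (ldF rho (F (nat_of_ord l)%:Z w)
                  (Xrec rho (F ^~ w) (G ^~ w) Xm1 l)
              - logdet (Xrec rho (F ^~ w) (G ^~ w) Xm1 l.+1)))
       @ \oo --> mutual_info P F G rho}).
Proof.
move=> N0 K0 sZ eZ F2 G2 rho0; split; last first.
  by move=> X0 hX; exact: info_rate_cvg.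
exists (fun n w => Wlim rho (F ^~ w) (G ^~ w) n); split.
- split; first exact: W_stationary.
  by move=> n w; exact: Wlim_hpd.
- by move=> n; apply: aeW => w; exact: (Wlim_rec rho0 (F ^~ w) (G ^~ w) n).
- by move=> W' _ hW' eW' n; exact: W_unique.
- exact: W_ergodic.
by rewrite (mutual_infoE K0 rho0 sZ F2 G2) EFinM (mean_split K0 rho0 sZ F2 G2).
Qed.
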